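(* Let $N\in\mathbb{N}$ and suppose that $f(\tau)$ is a meromorphic modular form of weight $k$ on $\Gamma_0(N)$ whose divisor is not supported at cusps (that is, $f$ has at least one zero or pole in the upper half plane $\mathbb{H}$). Let $y_1$ be the largest imaginary part of any points in the divisor of $f(\tau)$ lying in $\mathbb{H}$. If $$-\frac{\Theta(f(\tau))}{f(\tau)}=:\sum_{n\gg-\infty}a(n)q^n\qquad(q=e^{2\pi i\tau}),$$ then $$y_1=\limsup_{n\to\infty}\frac{\log|a(n)|}{2\pi n}.$$
   Context: $\Theta:=\frac{1}{2\pi i}\frac{d}{d\tau}$. The expansion of $-\Theta(f)/f$ is its $q$-expansion at the cusp $i\infty$, valid for $\mathrm{Im}(\tau)$ sufficiently large. The points in the divisor of $f$ lying in $\mathbb{H}$ are all zeros and poles of $f$ in $\mathbb{H}$ (the whole $\Gamma_0(N)$-orbits). Convention: $\log 0=-\infty$. *)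

(* Defs.v *)
From Stdlib Require Export Reals ZArith.
From Coquelicot Require Export Coquelicot.

Open Scope R_scope.

Definition Cexp (z : C) : C :=
  (RtoC (exp (Re z)) * (cos (Im z), sin (Im z)))%C.

Definition Cpowz (z : C) (n : Z) : C :=
  match n with
  | Z0 => 1%C
  | Zpos p => Cpow z (Pos.to_nat p)
  | Zneg p => Cinv (Cpow z (Pos.to_nat p))
  end.

Definition upper_half_plane (z : C) : Prop := 0 < Im z.

Definition holomorphic_at (f : C -> C) (z : C) : Prop :=
  locally z
    (fun w : C => ex_derive (K := C_AbsRing) (V := C_NormedModule) f w).

(* The value of [f] at [z] itself plays no role here.  No [m] qualifies when
   [f] vanishes identically near [z]. *)
Definition is_order (f : C -> C) (z : C) (m : Z) : Prop :=
  exists g : C -> C,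
    holomorphic_at g z /\ g z <> 0%C /\
    locally' z (fun w : C => f w = (Cpowz (w - z) m * g w)%C).

Definition is_pole (f : C -> C) (z : C) : Prop :=
  exists m : Z, (m < 0)%Z /\ is_order f z m.

(* A meromorphic function on the upper half plane is represented by a total
   function on [C]; its values at its poles and outside the upper half plane
   are irrelevant. *)
Definition meromorphic_on_H (f : C -> C) : Prop :=
  forall z : C, upper_half_plane z -> holomorphic_at f z \/ is_pole f z.

Definition in_divisor_H (f : C -> C) (z : C) : Prop :=
  upper_half_plane z /\ exists m : Z, m <> 0%Z /\ is_order f z m.

Record SL2Z : Set := mkSL2Z {
  mat_a : Z; mat_b : Z; mat_c : Z; mat_d : Z;
  mat_det : (mat_a * mat_d - mat_b * mat_c = 1)%Z
}.

Definition Gamma0 (N : nat) (g : SL2Z) : Prop := (Z.of_nat N | mat_c g)%Z.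

Definition ZtoC (n : Z) : C := RtoC (IZR n).

Definition automorphy (g : SL2Z) (tau : C) : C :=
  (ZtoC (mat_c g) * tau + ZtoC (mat_d g))%C.

Definition moebius (g : SL2Z) (tau : C) : C :=
  ((ZtoC (mat_a g) * tau + ZtoC (mat_b g)) / automorphy g tau)%C.

Definition slash (k : Z) (g : SL2Z) (f : C -> C) (tau : C) : C :=
  (Cpowz (automorphy g tau) (- k) * f (moebius g tau))%C.

(* [exp (2 pi i n tau / h)], the [n]-th power of the parameter [q^(1/h)]. *)
Definition qpow (h : nat) (n : Z) (tau : C) : C :=
  Cexp (RtoC (2 * PI) * Ci * ZtoC n * tau / RtoC (INR h))%C.

(* [F tau] is the sum over [n >= - M] of [a n * q^(n/h)] once [Im tau] is
   large. *)
Definition has_q_expansion (h : nat) (F : C -> C) (a : Z -> C) : Prop :=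
  exists M : nat,
    (forall n : Z, (n < - Z.of_nat M)%Z -> a n = 0%C) /\
    exists Y : R, forall tau : C, Y < Im tau ->
      is_series (K := C_AbsRing) (V := C_NormedModule)
        (fun j : nat =>
           let n := (Z.of_nat j - Z.of_nat M)%Z in (a n * qpow h n tau)%C)
        (F tau).

(* Meromorphy at the cusps is required of [f] slashed by every matrix of
   SL2(Z), with expansions in [q^(1/N)]: the width of every cusp of Gamma0(N)
   divides [N]. *)
Record meromorphic_modular_form (N : nat) (k : Z) (f : C -> C) : Prop := {
  mmf_meromorphic : meromorphic_on_H f;
  mmf_modular : forall (g : SL2Z) (tau : C),
    Gamma0 N g -> upper_half_plane tau ->
    holomorphic_at f tau -> holomorphic_at f (moebius g tau) ->
    f (moebius g tau) = (Cpowz (automorphy g tau) k * f tau)%C;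
  mmf_cusps : forall g : SL2Z,
    exists c : Z -> C, has_q_expansion N (slash k g f) c
}.

Definition Theta (f : C -> C) (tau : C) : C :=
  (/ (RtoC (2 * PI) * Ci) * C_derive f tau)%C.

Definition Rbar_ln (x : R) : Rbar :=
  if Rlt_dec 0 x then Finite (ln x) else m_infty.

(* [LimSup_seq] only accepts real sequences; this is its counterpart for
   extended real ones. *)
Definition Rbar_LimSup_seq (u : nat -> Rbar) : Rbar :=
  Inf_seq (fun m : nat => Sup_seq (fun n : nat => u (n + m)%nat)).

Lemma Rbar_LimSup_seq_real (u : nat -> R) :
  Rbar_LimSup_seq (fun n => Finite (u n)) = LimSup_seq u.
Proof. symmetry; apply LimSup_InfSup_seq. Qed.

(* Main.v *)
Require Import Defs.
From Stdlib Require Import Lra Lia Classical.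

(** Let [F = - Theta f / f].  Above height [y1] the form [f] is holomorphic and
    has no zeros, so [F] is holomorphic of period 1 there; at a point of the
    divisor of order [m] it has a simple pole with residue [- m / (2 pi i)].
    Seen as a function of [q], [F] is therefore holomorphic on the punctured
    disc of radius [exp (- 2 pi y1)] and on no larger one, and the claim is the
    Cauchy-Hadamard formula for its expansion at [q = 0].

    The two inequalities are proved in [growth_of_coefficients].  The
    coefficient [a n] is a Fourier coefficient of [F] on any line [Im tau = y]
    with [y > y1], because means over a period do not depend on the height
    ([period_mean_shift]); hence [|a n| <= C exp (2 pi n y)] for all such [y].
    Conversely, if eventually [|a n| <= exp (2 pi n y)] for some [y < y1], then
    [q^M F], which is the sum of its Fourier series on the whole half-plane
    [Im tau > y1] ([fourier_partial_sum]), is bounded there, whereas [F] is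
    unbounded along the vertical line above a point of the divisor of height
    [y1] ([log_derivative_order]).

    All of this rests on Cauchy's theorem, proved for rectangles by bisection
    ([goursat_rectangle]).  Applied over one period to the quotient
    [(F t - F t0) / (q (t - t0) - 1)], where [q t = exp (2 pi i t)], it gives a
    Cauchy formula for periodic functions, and expanding the kernel
    geometrically gives the Fourier series.
    Taylor's theorem ([taylor_estimate]) is the same statement for the periodic
    function [t |-> h (c + q t)].  Taylor expansions then show that derivatives
    of holomorphic functions are holomorphic ([cdiff_derive]), so that [F] is
    holomorphic where [f] is and does not vanish; that a holomorphic function
    either vanishes near a point or has a finite order there
    ([zero_or_finite_order]); and that a function vanishing near one point of a
    half-plane vanishes on all of it ([identity_half_plane]).  The last two
    exclude zeros of [f] above [y1]. *)

(** * Complex differentiability *)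

Definition cderiv (f : C -> C) (z l : C) : Prop :=
  is_derive (K := C_AbsRing) (V := C_NormedModule) f z l.
Definition cdiff (f : C -> C) (z : C) : Prop :=
  ex_derive (K := C_AbsRing) (V := C_NormedModule) f z.

(** The uniform structure of [C] is that of a product, whose balls are squares;
    the estimates below are made with the modulus. *)
Lemma locally_Cmod (z : C) (P : C -> Prop) :
  locally z P <->
  exists d : R, 0 < d /\ forall w : C, Cmod (w - z) < d -> P w.
Proof.
split.
- intros H. apply locally_C in H. destruct H as [d Hd].
  exists d; split; [apply cond_pos|].
  intros w Hw. apply Hd. exact Hw.
- intros [d [Hd H]]. apply locally_C. exists (mkposreal d Hd).
  intros w Hw. apply H. exact Hw.
Qed.

Lemma cderiv_eps (f : C -> C) (z l : C) :
  cderiv f z l <->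
  forall eps : R, 0 < eps ->
  exists d : R, 0 < d /\ forall w : C, Cmod (w - z) < d ->
    Cmod (f w - f z - l * (w - z)) <= eps * Cmod (w - z).
Proof.
split.
- intros [_ H] eps Heps.
  specialize (H z (fun P HP => HP) (mkposreal eps Heps)).
  destruct H as [d Hd]. exists d; split; [apply cond_pos|].
  intros w Hw. specialize (Hd w Hw). simpl in Hd.
  replace (f w - f z - l * (w - z))%C with
   (minus (minus (f w) (f z)) (scal (minus w z) l) : C_NormedModule).
  exact Hd.
  unfold minus, plus, opp, scal, mult; simpl.
  unfold scal; simpl; unfold mult; simpl. ring.
- intros H. split.
  + apply is_linear_scal_l.
  + intros x Hx.
    apply (is_filter_lim_locally_unique (V := AbsRing_NormedModule C_AbsRing)) in Hx.
    rewrite <- Hx.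
    intros [eps Heps]. destruct (H eps Heps) as [d [Hd Hw]].
    exists (mkposreal d Hd). intros w Hb. specialize (Hw w Hb). simpl.
    assert (E : (minus (minus (f w) (f z)) (scal (minus w z) l) : C_NormedModule)
                = (f w - f z - l * (w - z))%C).
    { unfold minus, plus, opp, scal, mult; simpl.
      unfold scal; simpl; unfold mult; simpl. ring. }
    change (Cmod (minus (minus (f w) (f z)) (scal (minus w z) l : C_NormedModule))
            <= eps * Cmod (w - z)).
    rewrite E. exact Hw.
Qed.

Lemma cdiff_continuous (f : C -> C) (z : C) :
  cdiff f z -> forall eps : R, 0 < eps ->
  exists d : R, 0 < d /\ forall w : C, Cmod (w - z) < d ->
    Cmod (f w - f z) < eps.
Proof.
intros [l Hl] eps Heps.
destruct (proj1 (cderiv_eps _ _ _) Hl 1 Rlt_0_1) as [d [Hd H]].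
pose proof (Cmod_ge_0 l) as Hl0.
exists (Rmin d (eps / (2 + Cmod l))).
assert (0 < eps / (2 + Cmod l)) by (apply Rdiv_lt_0_compat; lra).
split; [now apply Rmin_glb_lt|].
intros w Hw.
assert (H1 : Cmod (w - z) < d) by (eapply Rlt_le_trans; [apply Hw|apply Rmin_l]).
assert (H2 : Cmod (w - z) < eps / (2 + Cmod l)) by (eapply Rlt_le_trans; [apply Hw|apply Rmin_r]).
specialize (H w H1).
replace (f w - f z)%C with ((f w - f z - l * (w - z)) + l * (w - z))%C by ring.
eapply Rle_lt_trans; [apply Cmod_triangle|]. rewrite Cmod_mult.
apply (Rmult_lt_compat_r (2 + Cmod l)) in H2; [|lra].
unfold Rdiv in H2; rewrite Rmult_assoc, Rinv_l in H2; [|lra].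
pose proof (Cmod_ge_0 (w - z)). nra.
Qed.

(** [C] is a normed module over itself in two ways, with the uniform structure
    of the product or with that of the modulus.  The general rules for products
    and compositions live in the second structure. *)
Lemma cderiv_AbsRing f z l :
  cderiv f z l <-> is_derive (K := C_AbsRing) (V := AbsRing_NormedModule C_AbsRing) f z l.
Proof.
split.
- intros [_ H]. split; [apply is_linear_scal_l|]. intros x Hx. exact (H x Hx).
- intros [_ H]. split; [apply is_linear_scal_l|]. intros x Hx. exact (H x Hx).
Qed.

Lemma cderiv_const (c z : C) : cderiv (fun _ => c) z 0%C.
Proof. apply (is_derive_const (K := C_AbsRing) (V := C_NormedModule)). Qed.

Lemma cderiv_id (z : C) : cderiv (fun w => w) z 1%C.
Proof. apply cderiv_AbsRing, (is_derive_id (K := C_AbsRing)). Qed.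

Lemma cderiv_plus f g z l m :
  cderiv f z l -> cderiv g z m -> cderiv (fun w => f w + g w)%C z (l + m)%C.
Proof. apply (is_derive_plus (K := C_AbsRing) (V := C_NormedModule)). Qed.

Lemma cderiv_minus f g z l m :
  cderiv f z l -> cderiv g z m -> cderiv (fun w => f w - g w)%C z (l - m)%C.
Proof. apply (is_derive_minus (K := C_AbsRing) (V := C_NormedModule)). Qed.

Lemma cderiv_eq f z l m : cderiv f z l -> l = m -> cderiv f z m.
Proof. now intros H <-. Qed.

Lemma cderiv_mult f g z l m :
  cderiv f z l -> cderiv g z m ->
  cderiv (fun w => f w * g w)%C z (l * g z + f z * m)%C.
Proof.
intros Hf%cderiv_AbsRing Hg%cderiv_AbsRing. apply cderiv_AbsRing.
exact (is_derive_mult (K := C_AbsRing) f g z l m Hf Hg Cmult_comm).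
Qed.

Lemma cderiv_comp f g z l m :
  cderiv f (g z) l -> cderiv g z m -> cderiv (fun w => f (g w)) z (l * m)%C.
Proof.
intros Hf Hg%cderiv_AbsRing. rewrite Cmult_comm.
exact (is_derive_comp (K := C_AbsRing) (V := C_NormedModule) f g z l m Hf Hg).
Qed.

Lemma cderiv_ext_loc f g z l :
  locally z (fun w => f w = g w) -> cderiv f z l -> cderiv g z l.
Proof.
intros H. apply (is_derive_ext_loc (K := C_AbsRing) (V := C_NormedModule)).
now apply locally_C.
Qed.

Lemma cderiv_Cinv (z : C) : z <> 0%C -> cderiv Cinv z (- / (z * z))%C.
Proof.
intros Hz. apply cderiv_eps. intros eps Heps.
pose proof (proj1 (Cmod_gt_0 z) Hz) as Hm.
set (m := Cmod z) in *.
exists (Rmin (m / 2) (eps * m ^ 3 / 2)).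
assert (0 < m ^ 3) by now apply pow_lt.
split; [apply Rmin_glb_lt; nra|].
intros w Hw.
assert (H1 : Cmod (w - z) < m / 2) by (eapply Rlt_le_trans; [apply Hw|apply Rmin_l]).
assert (H2 : Cmod (w - z) < eps * m ^ 3 / 2) by (eapply Rlt_le_trans; [apply Hw|apply Rmin_r]).
assert (Hwm : m / 2 < Cmod w).
{ assert (m <= Cmod w + Cmod (w - z)).
  { rewrite <- (Cmod_opp (w - z)). unfold m.
    replace z with (w + - (w - z))%C at 1 by ring. apply Cmod_triangle. }
  lra. }
assert (Hw0 : w <> 0%C) by (apply Cmod_gt_0; lra).
replace (/ w - / z - - / (z * z) * (w - z))%C with ((w - z) * (w - z) * / (w * z * z))%C.
2: { field. split; assumption. }
rewrite !Cmod_mult, Cmod_inv, !Cmod_mult by (repeat apply Cmult_neq_0; assumption).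
fold m. pose proof (Cmod_ge_0 (w - z)) as H0. set (d := Cmod (w - z)) in *.
apply Rle_trans with (d * (d * / (m / 2 * m * m))).
- rewrite Rmult_assoc. apply Rmult_le_compat_l; [assumption|].
  apply Rmult_le_compat_l; [assumption|].
  apply Rinv_le_contravar; [repeat apply Rmult_lt_0_compat; lra|].
  repeat apply Rmult_le_compat_r; lra.
- rewrite (Rmult_comm eps). apply Rmult_le_compat_l; [assumption|].
  apply Rle_trans with ((eps * m ^ 3 / 2) * / (m / 2 * m * m)).
  + apply Rmult_le_compat_r; [|lra].
    apply Rlt_le, Rinv_0_lt_compat. repeat apply Rmult_lt_0_compat; lra.
  + right. field. lra.
Qed.

Lemma cderiv_inv g z m :
  cderiv g z m -> g z <> 0%C ->
  cderiv (fun w => / g w)%C z (- m / (g z * g z))%C.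
Proof.
intros Hg Hz.
eapply cderiv_eq. apply (cderiv_comp Cinv g). apply cderiv_Cinv; assumption. exact Hg.
field. exact Hz.
Qed.

Lemma cdiff_const c z : cdiff (fun _ => c) z.
Proof. eexists; apply cderiv_const. Qed.

Lemma cdiff_id z : cdiff (fun w => w) z.
Proof. eexists; apply cderiv_id. Qed.

Lemma cdiff_plus f g z : cdiff f z -> cdiff g z -> cdiff (fun w => f w + g w)%C z.
Proof. intros [l Hl] [m Hm]. exists (l + m)%C. now apply cderiv_plus. Qed.

Lemma cdiff_minus f g z : cdiff f z -> cdiff g z -> cdiff (fun w => f w - g w)%C z.
Proof. intros [l Hl] [m Hm]. exists (l - m)%C. now apply cderiv_minus. Qed.

Lemma cdiff_mult f g z : cdiff f z -> cdiff g z -> cdiff (fun w => f w * g w)%C z.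
Proof. intros [l Hl] [m Hm]. exists (l * g z + f z * m)%C. now apply cderiv_mult. Qed.

Lemma cdiff_inv g z : cdiff g z -> g z <> 0%C -> cdiff (fun w => / g w)%C z.
Proof. intros [l Hl] H. eexists. apply cderiv_inv; eassumption. Qed.

Lemma cdiff_comp f g z : cdiff f (g z) -> cdiff g z -> cdiff (fun w => f (g w)) z.
Proof. intros [l Hl] [m Hm]. exists (l * m)%C. now apply cderiv_comp. Qed.

Lemma cdiff_ext_loc f g z : locally z (fun w => f w = g w) -> cdiff f z -> cdiff g z.
Proof. intros H [l Hl]. exists l. eapply cderiv_ext_loc; eassumption. Qed.

(** * The exponential and the characters of period 1 *)

Lemma Cexp_plus (z w : C) : Cexp (z + w) = (Cexp z * Cexp w)%C.
Proof.
destruct z as [a b], w as [c d]. unfold Cexp, Cmult, Cplus, RtoC, Re, Im; simpl.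
rewrite exp_plus, cos_plus, sin_plus. f_equal; ring.
Qed.

Lemma Cexp_0 : Cexp 0 = 1%C.
Proof.
unfold Cexp, Re, Im; simpl. rewrite exp_0, cos_0, sin_0.
unfold Cmult, RtoC; simpl; f_equal; ring.
Qed.

Lemma Cmod_Cexp z : Cmod (Cexp z) = exp (Re z).
Proof.
unfold Cexp. rewrite Cmod_mult, Cmod_R, Rabs_pos_eq by (apply Rlt_le, exp_pos).
unfold Cmod; cbn [fst snd].
replace (cos (Im z) ^ 2 + sin (Im z) ^ 2) with 1.
rewrite sqrt_1; ring.
pose proof (sin2_cos2 (Im z)) as H; unfold Rsqr in H; nra.
Qed.

Lemma Cexp_nz z : Cexp z <> 0%C.
Proof. apply Cmod_gt_0. rewrite Cmod_Cexp. apply exp_pos. Qed.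

Lemma Cexp_opp z : Cexp (- z) = (/ Cexp z)%C.
Proof.
assert (H : (Cexp z * Cexp (- z) = 1)%C).
{ rewrite <- Cexp_plus, <- Cexp_0. f_equal. ring. }
pose proof (Cexp_nz z).
replace (Cexp (- z)) with (/ Cexp z * (Cexp z * Cexp (- z)))%C by (field; assumption).
rewrite H. ring.
Qed.

Lemma is_derive_eps (f : R -> R) x l eps :
  is_derive f x l -> 0 < eps ->
  exists d, 0 < d /\ forall y, Rabs (y - x) < d ->
    Rabs (f y - f x - l * (y - x)) <= eps * Rabs (y - x).
Proof.
intros [_ H] Heps.
specialize (H x (fun P HP => HP) (mkposreal eps Heps)).
destruct H as [d Hd]. exists d; split; [apply cond_pos|].
intros w Hw. specialize (Hd w Hw).
unfold minus, plus, opp, scal, mult, norm in Hd; simpl in Hd.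
unfold abs, mult in Hd; simpl in Hd.
replace (f w - f x - l * (w - x)) with (f w + - f x + - ((w + - x) * l)) by ring.
exact Hd.
Qed.

(** First-order expansions of [exp], [cos] and [sin] at 0; all other points
    follow because [Cexp] turns sums into products. *)
Lemma cderiv_Cexp_0 : cderiv Cexp 0%C 1%C.
Proof.
apply cderiv_eps. intros eps Heps.
set (e := Rmin (eps / 6) 1).
assert (He : 0 < e) by (apply Rmin_glb_lt; lra).
assert (He1 : e <= 1) by apply Rmin_r.
assert (He6 : 6 * e <= eps) by (pose proof (Rmin_l (eps / 6) 1); unfold e; lra).
assert (De : is_derive exp 0 1).
{ auto_derive; [easy|rewrite exp_0; ring]. }
assert (Dc : is_derive cos 0 0).
{ auto_derive; [easy|rewrite sin_0; ring]. }
assert (Ds : is_derive sin 0 1).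
{ auto_derive; [easy|rewrite cos_0; ring]. }
destruct (is_derive_eps _ _ _ e De He) as [d1 [Hd1 H1]].
destruct (is_derive_eps _ _ _ e Dc He) as [d2 [Hd2 H2]].
destruct (is_derive_eps _ _ _ e Ds He) as [d3 [Hd3 H3]].
rewrite exp_0 in H1. rewrite cos_0 in H2. rewrite sin_0 in H3.
set (d := Rmin (Rmin d1 d2) (Rmin d3 (e / 2))).
assert (Hd : 0 < d) by (repeat apply Rmin_glb_lt; lra).
exists d. split; [exact Hd|]. intros [x y].
replace ((x, y) - 0)%C with ((x, y) : C) by (unfold Cminus, Cplus, Copp, RtoC; simpl; f_equal; ring).
intros Hw.
pose proof (Rmax_Cmod (x, y)) as Hm; cbn [fst snd] in Hm.
set (m := Cmod (x, y)) in *.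
assert (Hx : Rabs x <= m) by (eapply Rle_trans; [apply Rmax_l|exact Hm]).
assert (Hy : Rabs y <= m) by (eapply Rle_trans; [apply Rmax_r|exact Hm]).
pose proof (Rmin_l (Rmin d1 d2) (Rmin d3 (e / 2))).
pose proof (Rmin_r (Rmin d1 d2) (Rmin d3 (e / 2))).
pose proof (Rmin_l d1 d2). pose proof (Rmin_r d1 d2).
pose proof (Rmin_l d3 (e / 2)). pose proof (Rmin_r d3 (e / 2)).
fold d in H, H0.
specialize (H1 x). specialize (H2 y). specialize (H3 y).
rewrite Rminus_0_r in H1, H2, H3.
specialize (H1 ltac:(lra)). specialize (H2 ltac:(lra)). specialize (H3 ltac:(lra)).
rewrite Cexp_0.
set (al := exp x - 1 - 1 * x) in *. set (be := cos y - 1 - 0 * y) in *.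
set (ga := sin y - 0 - 1 * y) in *.
replace (Cexp (x, y) - 1 - 1 * (x, y))%C with
  (RtoC (al + exp x * be) + Ci * RtoC ((exp x - 1) * y + exp x * ga))%C.
2: { unfold al, be, ga, Cexp, Ci, Cminus, Cplus, Copp, Cmult, RtoC, Re, Im; simpl.
     f_equal; ring. }
assert (Hex : Rabs (exp x - 1) <= e).
{ replace (exp x - 1) with (al + x) by (unfold al; ring).
  eapply Rle_trans; [apply Rabs_triang|]. pose proof (Rabs_pos x). nra. }
assert (Hex2 : 0 < exp x <= 2).
{ split; [apply exp_pos|]. apply Rabs_le_between in Hex. lra. }
eapply Rle_trans; [apply Cmod_triangle|].
rewrite Cmod_mult, Cmod_Ci, !Cmod_R, Rmult_1_l.
eapply Rle_trans; [apply Rplus_le_compat; apply Rabs_triang|].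
rewrite !Rabs_mult, (Rabs_pos_eq (exp x)) by lra.
pose proof (Rabs_pos x). pose proof (Rabs_pos y).
pose proof (Rabs_pos be). pose proof (Rabs_pos ga).
assert (exp x * Rabs be <= 2 * (e * m)) by nra.
assert (exp x * Rabs ga <= 2 * (e * m)) by nra.
assert (Rabs (exp x - 1) * Rabs y <= e * m).
{ apply Rmult_le_compat; auto using Rabs_pos. }
nra.
Qed.

Lemma cderiv_Cexp (z : C) : cderiv Cexp z (Cexp z).
Proof.
apply cderiv_ext_loc with (fun w => Cexp z * Cexp (w - z))%C.
- apply locally_Cmod. exists 1; split; [lra|]. intros w _.
  rewrite <- Cexp_plus. f_equal. ring.
- eapply cderiv_eq.
  + apply cderiv_mult; [apply cderiv_const|].
    apply (cderiv_comp Cexp (fun w => w - z)%C).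
    * replace (z - z)%C with (RtoC 0) by ring. apply cderiv_Cexp_0.
    * apply cderiv_minus; [apply cderiv_id|apply cderiv_const].
  + cbv beta. ring.
Qed.

(** [expi n t] is [q^n] at the point [t], for [q = exp (2 pi i t)]. *)
Definition expi (n : Z) (t : C) : C := Cexp (RtoC (2 * PI) * Ci * ZtoC n * t).

Lemma qpow_expi n t : qpow 1 n t = expi n t.
Proof. unfold qpow, expi. f_equal. simpl. field. Qed.

Lemma expi_plus n m t : expi (n + m) t = (expi n t * expi m t)%C.
Proof.
unfold expi. rewrite <- Cexp_plus. f_equal. unfold ZtoC. rewrite plus_IZR, RtoC_plus. ring.
Qed.

Lemma expi_add n s t : expi n (s + t) = (expi n s * expi n t)%C.
Proof. unfold expi. rewrite <- Cexp_plus. f_equal. ring. Qed.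

Lemma expi_0 t : expi 0 t = 1%C.
Proof. unfold expi, ZtoC. rewrite <- Cexp_0. f_equal. ring. Qed.

Lemma expi_nz n t : expi n t <> 0%C.
Proof. apply Cexp_nz. Qed.

Lemma expi_opp n t : expi (- n) t = (/ expi n t)%C.
Proof.
unfold expi. rewrite <- Cexp_opp. f_equal. unfold ZtoC. rewrite opp_IZR, RtoC_opp. ring.
Qed.

Lemma expi_neg n t : expi n (- t) = (/ expi n t)%C.
Proof. unfold expi. rewrite <- Cexp_opp. f_equal. ring. Qed.

Lemma Cmod_expi n t : Cmod (expi n t) = exp (- (2 * PI * IZR n * Im t)).
Proof.
unfold expi. rewrite Cmod_Cexp. f_equal. destruct t as [x y].
unfold ZtoC, Ci, Cmult, RtoC, Re, Im; simpl. ring.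
Qed.

Lemma expi_1_pow n t : expi (Z.of_nat n) t = Cpow (expi 1 t) n.
Proof.
induction n. apply expi_0.
rewrite Cpow_S, <- IHn, <- expi_plus. f_equal. lia.
Qed.

Lemma expi_n_1 n : expi n 1 = 1%C.
Proof.
assert (H1 : expi 1 1 = 1%C).
{ unfold expi. replace (RtoC (2 * PI) * Ci * ZtoC 1 * 1)%C with ((0, 2 * PI) : C).
  unfold Cexp, Re, Im; simpl. rewrite exp_0, cos_2PI, sin_2PI.
  unfold Cmult, RtoC; simpl; f_equal; ring.
  unfold ZtoC, Ci, Cmult, RtoC; simpl; apply injective_projections; simpl; ring. }
assert (H : forall m, expi (Z.of_nat m) 1 = 1%C).
{ intros m. rewrite expi_1_pow, H1, Cpow_1_l. reflexivity. }
destruct (Z_le_gt_dec 0 n).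
- rewrite <- (Z2Nat.id n) by lia. apply H.
- replace n with (- Z.of_nat (Z.to_nat (- n)))%Z by lia.
  rewrite expi_opp, H. field.
Qed.

Lemma expi_period n t : expi n (t + 1) = expi n t.
Proof. rewrite expi_add, expi_n_1. ring. Qed.

Lemma cderiv_expi n t :
  cderiv (expi n) t (RtoC (2 * PI) * Ci * ZtoC n * expi n t)%C.
Proof.
eapply cderiv_eq.
- apply (cderiv_comp Cexp (fun t => RtoC (2 * PI) * Ci * ZtoC n * t)%C).
  + apply cderiv_Cexp.
  + apply (cderiv_mult (fun _ => RtoC (2 * PI) * Ci * ZtoC n)%C); [apply cderiv_const|apply cderiv_id].
- cbv beta. unfold expi. ring.
Qed.

Lemma cdiff_expi n z : cdiff (expi n) z.
Proof. eexists. apply cderiv_expi. Qed.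

(** * Integrals of complex-valued functions of a real variable *)

Definition curve_continuous (f : R -> C) (t : R) : Prop :=
  continuous (U := C_UniformSpace) f t.

Definition CInt (f : R -> C) (a b : R) : C :=
  RInt (V := C_R_CompleteNormedModule) f a b.

Definition ex_CInt (f : R -> C) (a b : R) : Prop :=
  ex_RInt (V := C_R_CompleteNormedModule) f a b.

Lemma curve_continuous_eps f t :
  curve_continuous f t <-> forall eps, 0 < eps -> exists d, 0 < d /\
    forall s, Rabs (s - t) < d -> Cmod (f s - f t) < eps.
Proof.
split.
- intros H eps Heps.
  specialize (H (fun w => Cmod (w - f t) < eps)).
  destruct H as [d Hd].
  + apply locally_Cmod. exists eps; split; [exact Heps|tauto].
  + exists d. split; [apply cond_pos|]. exact Hd.
- intros H P HP. apply locally_Cmod in HP. destruct HP as [e [He HP]].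
  destruct (H e He) as [d [Hd Hs]].
  exists (mkposreal d Hd). intros s Hb. apply HP, Hs. exact Hb.
Qed.

Lemma ex_CInt_continuous f a b :
  a <= b -> (forall t, a <= t <= b -> curve_continuous f t) -> ex_CInt f a b.
Proof.
intros Hab H. apply (ex_RInt_continuous (V := C_R_CompleteNormedModule)).
rewrite Rmin_left, Rmax_right by assumption. exact H.
Qed.

Lemma CInt_ext f g a b : a <= b ->
  (forall t, a <= t <= b -> f t = g t) -> CInt f a b = CInt g a b.
Proof.
intros Hab H. apply (RInt_ext (V := C_R_CompleteNormedModule)).
rewrite Rmin_left, Rmax_right by assumption. intros t Ht. apply H; lra.
Qed.

Lemma CInt_plus f g a b : ex_CInt f a b -> ex_CInt g a b ->
  CInt (fun t => f t + g t)%C a b = (CInt f a b + CInt g a b)%C.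
Proof. apply (RInt_plus (V := C_R_CompleteNormedModule)). Qed.

Lemma CInt_minus f g a b : ex_CInt f a b -> ex_CInt g a b ->
  CInt (fun t => f t - g t)%C a b = (CInt f a b - CInt g a b)%C.
Proof. apply (RInt_minus (V := C_R_CompleteNormedModule)). Qed.

Lemma CInt_Chasles f a b c : ex_CInt f a b -> ex_CInt f b c ->
  (CInt f a b + CInt f b c)%C = CInt f a c.
Proof. apply (RInt_Chasles (V := C_R_CompleteNormedModule)). Qed.

Lemma CInt_const (z : C) a b : CInt (fun _ => z) a b = (RtoC (b - a) * z)%C.
Proof.
unfold CInt. rewrite (RInt_const (V := C_R_CompleteNormedModule)).
apply scal_R_Cmult.
Qed.

Lemma CInt_correct f a b : ex_CInt f a b ->
  is_RInt (V := C_R_NormedModule) f a b (CInt f a b).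
Proof. apply (RInt_correct (V := C_R_CompleteNormedModule)). Qed.

Lemma CInt_unique f a b l :
  is_RInt (V := C_R_NormedModule) f a b l -> CInt f a b = l.
Proof. apply (is_RInt_unique (V := C_R_CompleteNormedModule)). Qed.

Lemma is_CInt_Cmult (z : C) f a b l :
  is_RInt (V := C_R_NormedModule) f a b l ->
  is_RInt (V := C_R_NormedModule) (fun t => z * f t)%C a b (z * l)%C.
Proof.
intros H.
assert (H1 := is_RInt_fct_extend_fst _ _ _ _ H).
assert (H2 := is_RInt_fct_extend_snd _ _ _ _ H).
unfold Cmult. apply (is_RInt_fct_extend_pair (U := R_NormedModule) (V := R_NormedModule)); simpl.
- apply (is_RInt_minus (V := R_NormedModule)); apply (is_RInt_scal (V := R_NormedModule)); assumption.
- apply (is_RInt_plus (V := R_NormedModule)); apply (is_RInt_scal (V := R_NormedModule)); assumption.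
Qed.

Lemma ex_CInt_Cmult z f a b : ex_CInt f a b -> ex_CInt (fun t => z * f t)%C a b.
Proof. intros [l H]. exists (z * l)%C. now apply is_CInt_Cmult. Qed.

Lemma CInt_Cmult z f a b : ex_CInt f a b ->
  CInt (fun t => z * f t)%C a b = (z * CInt f a b)%C.
Proof. intros H. apply CInt_unique, is_CInt_Cmult, CInt_correct, H. Qed.

Lemma Cmod_norm_R (z : C) : norm (K := R_AbsRing) (V := C_R_NormedModule) z = Cmod z.
Proof.
destruct z as [x y]. unfold norm, Cmod; simpl. unfold prod_norm, norm; simpl.
unfold abs; simpl. f_equal. rewrite !Rmult_1_r.
rewrite <- !Rabs_mult, !Rabs_pos_eq; [reflexivity|nra|nra].
Qed.

Lemma Cmod_CInt_le f a b M : a <= b -> ex_CInt f a b ->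
  (forall t, a <= t <= b -> Cmod (f t) <= M) ->
  Cmod (CInt f a b) <= M * (b - a).
Proof.
intros Hab Hf HM.
rewrite <- Cmod_norm_R.
apply (norm_RInt_le (V := C_R_NormedModule) f (fun _ => M) a b); auto.
- intros t Ht. rewrite Cmod_norm_R. auto.
- now apply CInt_correct.
- rewrite Rmult_comm. apply (is_RInt_const (V := R_NormedModule)).
Qed.

Lemma ex_CInt_plus f g a b : ex_CInt f a b -> ex_CInt g a b ->
  ex_CInt (fun t => f t + g t)%C a b.
Proof. apply (ex_RInt_plus (V := C_R_CompleteNormedModule)). Qed.

Lemma ex_CInt_minus f g a b : ex_CInt f a b -> ex_CInt g a b ->
  ex_CInt (fun t => f t - g t)%C a b.
Proof. apply (ex_RInt_minus (V := C_R_CompleteNormedModule)). Qed.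

Lemma ex_CInt_const z a b : ex_CInt (fun _ => z) a b.
Proof. apply (ex_RInt_const (V := C_R_CompleteNormedModule)). Qed.

Definition C_continuous (f : C -> C) (z : C) : Prop :=
  forall eps, 0 < eps -> exists d, 0 < d /\
    forall w, Cmod (w - z) < d -> Cmod (f w - f z) < eps.

Lemma Cmod_horiz x y t : Cmod ((x, y) - (t, y))%C = Rabs (x - t).
Proof.
replace ((x, y) - (t, y))%C with (RtoC (x - t)) by (unfold RtoC; apply injective_projections; simpl; ring).
apply Cmod_R.
Qed.

Lemma Cmod_vert x y t : Cmod ((x, y) - (x, t))%C = Rabs (y - t).
Proof.
replace ((x, y) - (x, t))%C with (Ci * RtoC (y - t))%C by (unfold RtoC; apply injective_projections; simpl; ring).
rewrite Cmod_mult, Cmod_Ci, Cmod_R. ring.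
Qed.

Lemma C_continuous_horizontal f x y : C_continuous f (x, y) -> curve_continuous (fun t => f (t, y)) x.
Proof.
intros H. apply curve_continuous_eps. intros eps Heps. destruct (H eps Heps) as [d [Hd Hw]].
exists d; split; [exact Hd|]. intros s Hs. apply Hw. rewrite Cmod_horiz. exact Hs.
Qed.

Lemma C_continuous_vertical f x y : C_continuous f (x, y) -> curve_continuous (fun t => f (x, t)) y.
Proof.
intros H. apply curve_continuous_eps. intros eps Heps. destruct (H eps Heps) as [d [Hd Hw]].
exists d; split; [exact Hd|]. intros s Hs. apply Hw. rewrite Cmod_vert. exact Hs.
Qed.

Lemma Cmod_corner x y u v : Cmod ((x, y) - (u, v))%C <= Rabs (x - u) + Rabs (y - v).
Proof.
replace ((x, y) - (u, v))%C with (RtoC (x - u) + Ci * RtoC (y - v))%C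
  by (unfold RtoC; apply injective_projections; simpl; ring).
eapply Rle_trans; [apply Cmod_triangle|].
rewrite Cmod_mult, Cmod_Ci, !Cmod_R. lra.
Qed.

(** * Cauchy's theorem for rectangles *)

(** The contour integral along the boundary of the rectangle with sides
    [x = a], [x = b], [y = c], [y = d], counterclockwise. *)
Definition boundary_int (f : C -> C) (a b c d : R) : C :=
  (CInt (fun x => f (x, c)) a b - CInt (fun x => f (x, d)) a b
   + Ci * (CInt (fun y => f (b, y)) c d - CInt (fun y => f (a, y)) c d))%C.

Definition on_rect (P : C -> Prop) a b c d : Prop :=
  forall x y, a <= x <= b -> c <= y <= d -> P (x, y).

Lemma boundary_int_split f a m b c n d :
  a <= m <= b -> c <= n <= d -> on_rect (C_continuous f) a b c d ->
  boundary_int f a b c d =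
  (boundary_int f a m c n + boundary_int f m b c n
   + boundary_int f a m n d + boundary_int f m b n d)%C.
Proof.
intros Hm Hn H.
assert (Hh : forall y u v, a <= u -> u <= v -> v <= b -> c <= y <= d ->
  ex_CInt (fun x => f (x, y)) u v).
{ intros y u v Hu Huv Hv Hy. apply ex_CInt_continuous; [exact Huv|].
  intros t Ht. apply C_continuous_horizontal, H; lra. }
assert (Hv : forall x u v, c <= u -> u <= v -> v <= d -> a <= x <= b ->
  ex_CInt (fun y => f (x, y)) u v).
{ intros y u v Hu Huv Hv Hy. apply ex_CInt_continuous; [exact Huv|].
  intros t Ht. apply C_continuous_vertical, H; lra. }
unfold boundary_int.
rewrite <- (CInt_Chasles (fun x => f (x, c)) a m b) by (apply Hh; lra).
rewrite <- (CInt_Chasles (fun x => f (x, d)) a m b) by (apply Hh; lra).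
rewrite <- (CInt_Chasles (fun y => f (a, y)) c n d) by (apply Hv; lra).
rewrite <- (CInt_Chasles (fun y => f (b, y)) c n d) by (apply Hv; lra).
ring.
Qed.

(** An affine function has constant increments between opposite sides, so its
    integrals along them cancel; only the deviation [e] of [f] from an affine
    function contributes, in proportion to the length of the boundary. *)
Lemma boundary_int_affine f p l e a b c d :
  a <= b -> c <= d -> on_rect (C_continuous f) a b c d ->
  on_rect (fun w => Cmod (f w - f p - l * (w - p)) <= e) a b c d ->
  Cmod (boundary_int f a b c d) <= 2 * e * ((b - a) + (d - c)).
Proof.
intros Hab Hcd Hf H.
assert (Hh : forall y, c <= y <= d -> ex_CInt (fun x => f (x, y)) a b).
{ intros y Hy. apply ex_CInt_continuous; [exact Hab|]. intros t Ht. apply C_continuous_horizontal, Hf; lra. }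
assert (Hv : forall x, a <= x <= b -> ex_CInt (fun y => f (x, y)) c d).
{ intros y Hy. apply ex_CInt_continuous; [exact Hcd|]. intros t Ht. apply C_continuous_vertical, Hf; lra. }
assert (E : boundary_int f a b c d =
  (CInt (fun x => (f (x, c) - f (x, d)) - l * (Ci * RtoC (c - d))) a b
   + Ci * CInt (fun y => (f (b, y) - f (a, y)) - l * RtoC (b - a)) c d)%C).
{ assert (Eh : CInt (fun x => (f (x, c) - f (x, d)) - l * (Ci * RtoC (c - d)))%C a b
    = (CInt (fun x => f (x, c)) a b - CInt (fun x => f (x, d)) a b
       - RtoC (b - a) * (l * (Ci * RtoC (c - d))))%C).
  { rewrite <- CInt_const, <- CInt_minus by (apply Hh; lra).
    apply (CInt_minus (fun x => f (x, c) - f (x, d))%C);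
      [apply ex_CInt_minus; apply Hh; lra|apply ex_CInt_const]. }
  assert (Ev : CInt (fun y => (f (b, y) - f (a, y)) - l * RtoC (b - a))%C c d
    = (CInt (fun y => f (b, y)) c d - CInt (fun y => f (a, y)) c d
       - RtoC (d - c) * (l * RtoC (b - a)))%C).
  { rewrite <- CInt_const, <- CInt_minus by (apply Hv; lra).
    apply (CInt_minus (fun y => f (b, y) - f (a, y))%C);
      [apply ex_CInt_minus; apply Hv; lra|apply ex_CInt_const]. }
  rewrite Eh, Ev. unfold boundary_int. rewrite !RtoC_minus. ring. }
rewrite E. eapply Rle_trans; [apply Cmod_triangle|].
rewrite Cmod_mult, Cmod_Ci, Rmult_1_l, Rmult_plus_distr_l.
(* the increment of the affine part is the same along opposite sides *)
assert (D : forall z w k : C, k = (l * (z - w))%C ->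
  Cmod (f z - f p - l * (z - p)) <= e -> Cmod (f w - f p - l * (w - p)) <= e ->
  Cmod (f z - f w - k) <= 2 * e).
{ intros z w k -> Hz Hw.
  replace (f z - f w - l * (z - w))%C
    with ((f z - f p - l * (z - p)) + - (f w - f p - l * (w - p)))%C by ring.
  eapply Rle_trans; [apply Cmod_triangle|]. rewrite Cmod_opp. lra. }
apply Rplus_le_compat; apply Cmod_CInt_le; try assumption.
- apply ex_CInt_minus; [apply ex_CInt_minus; apply Hh; lra|apply ex_CInt_const].
- intros t Ht. apply D; try (apply H; lra).
  f_equal. unfold RtoC; apply injective_projections; simpl; ring.
- apply ex_CInt_minus; [apply ex_CInt_minus; apply Hv; lra|apply ex_CInt_const].
- intros t Ht. apply D; try (apply H; lra).
  f_equal. unfold RtoC; apply injective_projections; simpl; ring.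
Qed.

(** By additivity at least one of the four quarters carries a quarter of the
    integral.  The choice is a decidable comparison of reals, hence the
    informative statement: it lets the bisection be a recursive definition. *)
Lemma boundary_int_quarter f a c w h :
  {p : R * R | (fst p = a \/ fst p = a + w / 2) /\ (snd p = c \/ snd p = c + h / 2) /\
    (0 <= w -> 0 <= h -> on_rect (C_continuous f) a (a + w) c (c + h) ->
     Cmod (boundary_int f a (a + w) c (c + h))
      <= 4 * Cmod (boundary_int f (fst p) (fst p + w / 2) (snd p) (snd p + h / 2)))}.
Proof.
set (B := boundary_int f a (a + w) c (c + h)).
set (B1 := boundary_int f a (a + w / 2) c (c + h / 2)).
set (B2 := boundary_int f (a + w / 2) (a + w / 2 + w / 2) c (c + h / 2)).
set (B3 := boundary_int f a (a + w / 2) (c + h / 2) (c + h / 2 + h / 2)).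
destruct (Rle_dec (Cmod B) (4 * Cmod B1)) as [H1|H1].
{ exists (a, c). simpl. auto. }
destruct (Rle_dec (Cmod B) (4 * Cmod B2)) as [H2|H2].
{ exists (a + w / 2, c). simpl. auto. }
destruct (Rle_dec (Cmod B) (4 * Cmod B3)) as [H3|H3].
{ exists (a, c + h / 2). simpl. auto. }
exists (a + w / 2, c + h / 2). simpl. split; [now right|]. split; [now right|].
intros Hw Hh Hf.
assert (E := boundary_int_split f a (a + w / 2) (a + w) c (c + h / 2) (c + h)
  ltac:(lra) ltac:(lra) Hf).
assert (Ew : a + w / 2 + w / 2 = a + w) by lra.
assert (Eh : c + h / 2 + h / 2 = c + h) by lra.
unfold B2 in H2; rewrite Ew in H2. unfold B3 in H3; rewrite Eh in H3. rewrite Ew, Eh.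
unfold B1 in H1. fold B in E.
assert (T := Cmod_triangle (boundary_int f a (a + w / 2) c (c + h / 2)
  + boundary_int f (a + w / 2) (a + w) c (c + h / 2)
  + boundary_int f a (a + w / 2) (c + h / 2) (c + h))
  (boundary_int f (a + w / 2) (a + w) (c + h / 2) (c + h))).
rewrite <- E in T.
assert (T2 := Cmod_triangle (boundary_int f a (a + w / 2) c (c + h / 2)
  + boundary_int f (a + w / 2) (a + w) c (c + h / 2))
  (boundary_int f a (a + w / 2) (c + h / 2) (c + h))).
assert (T3 := Cmod_triangle (boundary_int f a (a + w / 2) c (c + h / 2))
  (boundary_int f (a + w / 2) (a + w) c (c + h / 2))).
lra.
Qed.

(** The point is the supremum of the left ends: each of them stays below every
    right end. *)
Lemma bisection_point (u : nat -> R) w :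
  0 <= w -> (forall n, u (S n) = u n \/ u (S n) = u n + w / 2 ^ n / 2) ->
  exists p, forall n, u n <= p <= u n + w / 2 ^ n.
Proof.
intros Hw Hu.
assert (Hpos : forall n, 0 <= w / 2 ^ n).
{ intros n. apply Rdiv_le_0_compat; [exact Hw|]. apply pow_lt; lra. }
assert (HS : forall n, w / 2 ^ S n = w / 2 ^ n / 2).
{ intros n. simpl. field. apply pow_nonzero; lra. }
assert (Hmono : forall n m, (n <= m)%nat -> u n <= u m /\ u m + w / 2 ^ m <= u n + w / 2 ^ n).
{ intros n m H. induction H as [|m H IH]; [lra|].
  rewrite HS. pose proof (Hpos m). destruct (Hu m) as [->| ->]; lra. }
assert (Hle : forall n m, u n <= u m + w / 2 ^ m).
{ intros n m. destruct (Nat.le_ge_cases n m) as [H|H].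
  - pose proof (Hmono _ _ H). pose proof (Hpos m). lra.
  - pose proof (Hmono _ _ H). pose proof (Hpos n). lra. }
destruct (completeness (fun x => exists n, x = u n)) as [p [Hp1 Hp2]].
- exists (u 0%nat + w / 2 ^ 0). intros x [n ->]. apply Hle.
- exists (u 0%nat). now exists 0%nat.
- exists p. intros n. split.
  + apply Hp1. now exists n.
  + apply Hp2. intros x [m ->]. apply Hle.
Qed.

(** Bisection yields rectangles shrinking to a point [p], the [n]-th carrying at
    least [4^-n] of the integral.  Differentiability at [p] makes [f] affine up
    to [e] times the diameter, so that by [boundary_int_affine] the integral over
    the [n]-th rectangle is [O (e 4^-n)], with [e] arbitrarily small. *)
Theorem goursat_rectangle f a b c d :
  a <= b -> c <= d -> on_rect (cdiff f) a b c d -> boundary_int f a b c d = 0%C.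
Proof.
intros Hab Hcd Hf.
set (w := b - a). set (h := d - c).
assert (Hw : 0 <= w) by (unfold w; lra). assert (Hh : 0 <= h) by (unfold h; lra).
replace b with (a + w) in * by (unfold w; ring).
replace d with (c + h) in * by (unfold h; ring).
clearbody w h. clear b d Hab Hcd.
assert (Hc : on_rect (C_continuous f) a (a + w) c (c + h)).
{ intros x y Hx Hy. unfold C_continuous. now apply cdiff_continuous, Hf. }
set (pt := fix pt n := match n with O => (a, c) | S m =>
  proj1_sig (boundary_int_quarter f (fst (pt m)) (snd (pt m)) (w / 2 ^ m) (h / 2 ^ m)) end).
assert (HS : forall x n, x / 2 ^ S n = x / 2 ^ n / 2).
{ intros x n. simpl. field. apply pow_nonzero; lra. }
assert (Hpos : forall x n, 0 <= x -> 0 <= x / 2 ^ n).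
{ intros x n Hx. apply Rdiv_le_0_compat; [exact Hx|]. apply pow_lt; lra. }
set (B := fun n => boundary_int f (fst (pt n)) (fst (pt n) + w / 2 ^ n)
                                  (snd (pt n)) (snd (pt n) + h / 2 ^ n)).
assert (Hpt : forall n,
  (fst (pt (S n)) = fst (pt n) \/ fst (pt (S n)) = fst (pt n) + w / 2 ^ n / 2) /\
  (snd (pt (S n)) = snd (pt n) \/ snd (pt (S n)) = snd (pt n) + h / 2 ^ n / 2) /\
  (on_rect (C_continuous f) (fst (pt n)) (fst (pt n) + w / 2 ^ n)
           (snd (pt n)) (snd (pt n) + h / 2 ^ n) ->
   Cmod (B n) <= 4 * Cmod (B (S n)))).
{ intros n. unfold B. rewrite !HS.
  change (pt (S n)) with (proj1_sig (boundary_int_quarter f (fst (pt n)) (snd (pt n)) (w / 2 ^ n) (h / 2 ^ n))).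
  destruct (boundary_int_quarter _ _ _ _ _) as [q [H1 [H2 H3]]]; simpl.
  repeat split; auto. }
assert (Hin : forall n, (a <= fst (pt n) /\ fst (pt n) + w / 2 ^ n <= a + w) /\
                        (c <= snd (pt n) /\ snd (pt n) + h / 2 ^ n <= c + h)).
{ induction n as [|n [IH1 IH2]].
  - simpl. lra.
  - rewrite !HS. destruct (Hpt n) as [H1 [H2 _]].
    pose proof (Hpos w n Hw). pose proof (Hpos h n Hh).
    destruct H1 as [-> | ->], H2 as [-> | ->]; lra. }
assert (HB : forall n, Cmod (B 0%nat) <= 4 ^ n * Cmod (B n)).
{ induction n as [|n IH]; [simpl; lra|].
  assert (H : Cmod (B n) <= 4 * Cmod (B (S n))).
  { apply Hpt. intros x y Hx Hy. destruct (Hin n). apply Hc; lra. }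
  assert (0 < 4 ^ n) by (apply pow_lt; lra).
  change (4 ^ S n) with (4 * 4 ^ n). nra. }
destruct (bisection_point (fun n => fst (pt n)) w Hw (fun n => proj1 (Hpt n))) as [x Hx].
destruct (bisection_point (fun n => snd (pt n)) h Hh (fun n => proj1 (proj2 (Hpt n)))) as [y Hy].
assert (Hxy : cdiff f (x, y)).
{ pose proof (Hx 0%nat). pose proof (Hy 0%nat). simpl in *. apply Hf; lra. }
destruct Hxy as [l Hl].
assert (Hl' := proj1 (cderiv_eps _ _ _) Hl).
assert (E0 : boundary_int f a (a + w) c (c + h) = B 0%nat).
{ unfold B. simpl. unfold Rdiv. now rewrite Rinv_1, !Rmult_1_r. }
rewrite E0. apply Cmod_eq_0. apply Rle_antisym; [|apply Cmod_ge_0].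
apply le_epsilon. intros eps Heps.
set (s := w + h).
assert (Hs0 : 0 <= s) by (unfold s; lra).
(* The [n]-th rectangle contributes at most [2 e s^2 / 4^n]; adding 1 to [s^2]
   covers degenerate rectangles. *)
set (e := eps / (2 * (s * s + 1))).
assert (He : 0 < e) by (apply Rdiv_lt_0_compat; nra).
destruct (Hl' e He) as [dl [Hdl Hd]].
assert (Hn : exists n, s / 2 ^ n < dl).
{ destruct (pow_lt_1_zero (/ 2) ltac:(rewrite Rabs_pos_eq; lra) (dl / (s + 1))
    ltac:(apply Rdiv_lt_0_compat; lra)) as [n Hn].
  exists n. specialize (Hn n (Nat.le_refl n)).
  rewrite pow_inv, Rabs_pos_eq in Hn by (apply Rlt_le, Rinv_0_lt_compat, pow_lt; lra).
  assert (0 < / 2 ^ n) by (apply Rinv_0_lt_compat, pow_lt; lra).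
  apply (Rmult_lt_compat_r (s + 1)) in Hn; [|lra].
  replace (dl / (s + 1) * (s + 1)) with dl in Hn by (field; lra).
  unfold Rdiv. nra. }
destruct Hn as [n Hn].
assert (Hsn : w / 2 ^ n + h / 2 ^ n = s / 2 ^ n) by (unfold s, Rdiv; ring).
pose proof (Hpos w n Hw). pose proof (Hpos h n Hh).
assert (Hbn : Cmod (B n) <= 2 * (e * (s / 2 ^ n)) * (s / 2 ^ n)).
{ unfold B. eapply Rle_trans.
  - apply (boundary_int_affine f (x, y) l (e * (s / 2 ^ n))); try lra.
    + intros u v Hu Hv. destruct (Hin n). apply Hc; lra.
    + intros u v Hu Hv.
      assert (Hcor : Cmod ((u, v) - (x, y))%C <= s / 2 ^ n).
      { eapply Rle_trans; [apply Cmod_corner|].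
        specialize (Hx n). specialize (Hy n). cbv beta in Hx, Hy.
        assert (Rabs (u - x) <= w / 2 ^ n) by (apply Rabs_le; lra).
        assert (Rabs (v - y) <= h / 2 ^ n) by (apply Rabs_le; lra). lra. }
      eapply Rle_trans; [apply Hd; lra|]. apply Rmult_le_compat_l; lra.
  - right. f_equal. lra. }
eapply Rle_trans; [apply (HB n)|].
assert (H4 : 4 ^ n = 2 ^ n * 2 ^ n) by (rewrite <- Rpow_mult_distr; f_equal; lra).
apply Rle_trans with (4 ^ n * (2 * (e * (s / 2 ^ n)) * (s / 2 ^ n))).
{ apply Rmult_le_compat_l; [apply pow_le; lra|exact Hbn]. }
rewrite H4.
replace (2 ^ n * 2 ^ n * (2 * (e * (s / 2 ^ n)) * (s / 2 ^ n))) with (e * (2 * (s * s)))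
  by (field; apply pow_nonzero; lra).
rewrite Rplus_0_l.
assert (eps = e * (2 * (s * s + 1))) by (unfold e; field; nra).
nra.
Qed.

(** * Means over a period *)

(** Compactness of [[a, b]] for properties of subintervals that are additive and
    hold near every point: the supremum of the [t] with [P a t] must be [b]. *)
Lemma interval_induction (P : R -> R -> Prop) a b :
  a <= b ->
  (forall u m v, P u m -> P m v -> P u v) ->
  (forall x, a <= x <= b -> exists d, 0 < d /\
     forall u v, a <= u -> v <= b -> u <= x <= v -> v - u < d -> P u v) ->
  P a b.
Proof.
intros Hab Hadd Hloc.
destruct (completeness (fun t => a <= t <= b /\ P a t)) as [s [Hs1 Hs2]].
- exists b. intros t Ht. lra.
- exists a. split; [lra|]. destruct (Hloc a) as [d [Hd H]]; [lra|]. apply H; lra.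
- assert (Hs : a <= s <= b).
  { split.
    - apply Hs1. split; [lra|]. destruct (Hloc a) as [d [Hd H]]; [lra|]. apply H; lra.
    - apply Hs2. intros t Ht. lra. }
  destruct (Hloc s Hs) as [d [Hd H]].
  assert (Ht : exists t, (a <= t <= b /\ P a t) /\ s - d / 3 < t).
  { destruct (Classical_Prop.classic (exists t, (a <= t <= b /\ P a t) /\ s - d / 3 < t)) as [K|K].
    - exact K.
    - exfalso. assert (s <= s - d / 3); [|lra]. apply Hs2. intros t Ht.
      apply Rnot_lt_le. intros Hlt. apply K. now exists t. }
  destruct Ht as [t [[Htab HPt] Hts]].
  assert (t <= s) by (apply Hs1; auto).
  set (r := Rmin b (s + d / 3)).
  assert (r <= b) by apply Rmin_l. assert (r <= s + d / 3) by apply Rmin_r.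
  assert (s <= r) by (apply Rmin_glb; lra).
  assert (P a r). { apply Hadd with t; [exact HPt|]. apply H; lra. }
  assert (r <= s). { apply Hs1. split; [lra|assumption]. }
  replace b with r; [assumption|].
  destruct (Rle_dec b (s + d / 3)); unfold r in *; [now apply Rmin_left|].
  rewrite Rmin_right in * by lra. lra.
Qed.

Lemma curve_bounded g a b : a <= b -> (forall t, a <= t <= b -> curve_continuous g t) ->
  exists M, forall t, a <= t <= b -> Cmod (g t) <= M.
Proof.
intros Hab H.
apply (interval_induction (fun u v => exists M, forall t, u <= t <= v -> Cmod (g t) <= M)); [exact Hab| |].
- intros u m v [M HM] [M' HM']. exists (Rmax M M'). intros t Ht.
  destruct (Rle_dec t m).
  + eapply Rle_trans; [apply HM; lra|apply Rmax_l].
  + eapply Rle_trans; [apply HM'; lra|apply Rmax_r].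
- intros x Hx. destruct (proj1 (curve_continuous_eps _ _) (H x Hx) 1 Rlt_0_1) as [d [Hd K]].
  exists d. split; [exact Hd|]. intros u v Hu Hv Hux Huv.
  exists (Cmod (g x) + 1). intros t Ht.
  specialize (K t ltac:(apply Rabs_def1; lra)).
  replace (g t) with (g x + (g t - g x))%C by ring.
  eapply Rle_trans; [apply Cmod_triangle|]. lra.
Qed.

Definition period_mean (G : C -> C) (y : R) : C := CInt (fun x => G (x, y)) 0 1.
Definition ex_period_mean (G : C -> C) (y : R) : Prop := ex_CInt (fun x => G (x, y)) 0 1.

Lemma ex_period_mean_cont G y : (forall x, 0 <= x <= 1 -> C_continuous G (x, y)) -> ex_period_mean G y.
Proof. intros H. apply ex_CInt_continuous; [lra|]. intros t Ht. now apply C_continuous_horizontal, H. Qed.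

Lemma ex_period_mean_diff G y : (forall x, cdiff G (x, y)) -> ex_period_mean G y.
Proof.
intros H. apply ex_period_mean_cont. intros x _. unfold C_continuous. now apply cdiff_continuous.
Qed.

Lemma period_mean_ext G H y : (forall x, G (x, y) = H (x, y)) -> period_mean G y = period_mean H y.
Proof. intros E. unfold period_mean. apply CInt_ext; [lra|]. intros t _. apply E. Qed.

Lemma Cmod_period_mean_le G y M : ex_period_mean G y ->
  (forall x, Cmod (G (x, y)) <= M) -> Cmod (period_mean G y) <= M.
Proof.
intros HG H. replace M with (M * (1 - 0)) by ring.
unfold period_mean. apply Cmod_CInt_le; [lra|exact HG|]. intros t _. apply H.
Qed.

Lemma period_mean_plus G H y : ex_period_mean G y -> ex_period_mean H y ->
  period_mean (fun z => G z + H z)%C y = (period_mean G y + period_mean H y)%C.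
Proof. apply CInt_plus. Qed.

Lemma period_mean_minus G H y : ex_period_mean G y -> ex_period_mean H y ->
  period_mean (fun z => G z - H z)%C y = (period_mean G y - period_mean H y)%C.
Proof. apply CInt_minus. Qed.

Lemma period_mean_Cmult c G y : ex_period_mean G y ->
  period_mean (fun z => c * G z)%C y = (c * period_mean G y)%C.
Proof. unfold period_mean, ex_period_mean. intros H. exact (CInt_Cmult c _ 0 1 H). Qed.

Lemma period_mean_const c y : period_mean (fun _ => c) y = c.
Proof. unfold period_mean. rewrite CInt_const, Rminus_0_r. ring. Qed.

Lemma ex_period_mean_plus G H y : ex_period_mean G y -> ex_period_mean H y -> ex_period_mean (fun z => G z + H z)%C y.
Proof. apply ex_CInt_plus. Qed.

Lemma ex_period_mean_minus G H y : ex_period_mean G y -> ex_period_mean H y -> ex_period_mean (fun z => G z - H z)%C y.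
Proof. apply ex_CInt_minus. Qed.

Lemma ex_period_mean_Cmult c G y : ex_period_mean G y -> ex_period_mean (fun z => c * G z)%C y.
Proof. apply ex_CInt_Cmult. Qed.

(** Cauchy's theorem over one period: by periodicity the vertical sides
    cancel. *)
Lemma period_mean_shift G y1 y2 : y1 <= y2 ->
  (forall z, y1 <= Im z <= y2 -> cdiff G z) ->
  (forall y, y1 <= y <= y2 -> G (1, y) = G (0, y)) ->
  period_mean G y1 = period_mean G y2.
Proof.
intros Hy Hd Hp.
assert (H := goursat_rectangle G 0 1 y1 y2 ltac:(lra) Hy ltac:(intros u v Hu Hv; apply Hd; exact Hv)).
unfold boundary_int in H.
rewrite (CInt_ext (fun y => G (1, y)) (fun y => G (0, y)) y1 y2 Hy Hp) in H.
apply Ceq_minus. rewrite <- H. unfold period_mean. ring.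
Qed.

(** Continuity along the compact segment [0 <= x <= 1] at height [v] is uniform
    in the vertical direction. *)
Lemma period_mean_continuous G v :
  (forall x, 0 <= x <= 1 -> C_continuous G (x, v)) ->
  forall eps, 0 < eps -> exists d, 0 < d /\ forall y, Rabs (y - v) < d ->
    ex_period_mean G y -> Cmod (period_mean G y - period_mean G v) <= eps.
Proof.
intros HG eps Heps.
assert (T : exists d, 0 < d /\ forall x, 0 <= x <= 1 -> forall y, Rabs (y - v) < d ->
   Cmod (G (x, y) - G (x, v)) <= eps).
{ apply (interval_induction (fun a b => exists d, 0 < d /\ forall x, a <= x <= b ->
   forall y, Rabs (y - v) < d -> Cmod (G (x, y) - G (x, v)) <= eps)); [lra| |].
  - intros u m w [d1 [Hd1 H1]] [d2 [Hd2 H2]]. exists (Rmin d1 d2).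
    split; [now apply Rmin_glb_lt|]. intros x Hx y Hy.
    pose proof (Rmin_l d1 d2). pose proof (Rmin_r d1 d2).
    destruct (Rle_dec x m); [apply H1|apply H2]; lra.
  - intros x Hx. destruct (HG x Hx (eps / 2) ltac:(lra)) as [d [Hd H]].
    exists (d / 2). split; [lra|]. intros a b _ _ Hab1 Hab2.
    exists (d / 2). split; [lra|]. intros t Ht y Hy.
    assert (A : Rabs (t - x) < d / 2) by (apply Rabs_def1; lra).
    assert (A0 : Rabs (v - v) < d / 2) by (rewrite Rminus_diag, Rabs_R0; lra).
    pose proof (Cmod_corner t y x v). pose proof (Cmod_corner t v x v).
    pose proof (H (t, y) ltac:(lra)). pose proof (H (t, v) ltac:(lra)).
    replace (G (t, y) - G (t, v))%C with ((G (t, y) - G (x, v)) + - (G (t, v) - G (x, v)))%C by ring.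
    eapply Rle_trans; [apply Cmod_triangle|]. rewrite Cmod_opp. lra. }
destruct T as [d [Hd H]]. exists d. split; [exact Hd|]. intros y Hy Hex.
unfold period_mean. rewrite <- CInt_minus by (auto; apply ex_period_mean_cont, HG).
replace eps with (eps * (1 - 0)) by ring.
apply Cmod_CInt_le; [lra| |].
- apply ex_CInt_minus; [exact Hex|]. now apply ex_period_mean_cont.
- intros t Ht. now apply H.
Qed.

Lemma expi_period_pair n y : expi n (1, y) = expi n (0, y).
Proof.
rewrite <- (expi_period n (0, y)). f_equal. apply injective_projections; simpl; ring.
Qed.

Lemma exp_opp_small (k eps : R) : 0 < k -> 0 < eps ->
  exists Y, forall y, Y <= y -> exp (- (k * y)) <= eps.
Proof.
intros Hk He. exists (- ln eps / k). intros y Hy.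
apply (Rmult_le_compat_l k) in Hy; [|lra].
replace (k * (- ln eps / k)) with (- ln eps) in Hy by (field; lra).
pose proof (exp_ln eps He) as E.
destruct (Rle_lt_or_eq_dec (- (k * y)) (ln eps)) as [H|H]; [lra| |].
- apply exp_increasing in H. lra.
- rewrite H. lra.
Qed.

Lemma Cmod_eps_eq (z w : C) : (forall eps, 0 < eps -> Cmod (z - w) <= eps) -> z = w.
Proof.
intros H. apply Ceq_minus, Cmod_eq_0. apply Rle_antisym; [|apply Cmod_ge_0].
apply le_epsilon. intros eps He. rewrite Rplus_0_l. auto.
Qed.

(** The mean does not depend on the height, while its bound
    [exp (- 2 pi n y)] tends to 0 at one of the two ends of the vertical
    axis. *)
Lemma period_mean_expi n y : n <> 0%Z -> period_mean (expi n) y = 0%C.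
Proof.
intros Hn.
assert (H : forall y1 y2, y1 <= y2 -> period_mean (expi n) y1 = period_mean (expi n) y2).
{ intros y1 y2 Hy. apply period_mean_shift; [exact Hy|intros; apply cdiff_expi|].
  intros; apply expi_period_pair. }
assert (B : forall u, Cmod (period_mean (expi n) u) <= exp (- (2 * PI * IZR n * u))).
{ intros u. apply Cmod_period_mean_le; [apply ex_period_mean_diff; intros; apply cdiff_expi|].
  intros x. rewrite Cmod_expi. apply Rle_refl. }
pose proof PI_RGT_0.
apply Cmod_eps_eq. intros eps Heps. replace (period_mean (expi n) y - 0)%C with (period_mean (expi n) y) by ring.
destruct (Z_lt_ge_dec 0 n) as [Hpos|Hneg].
- assert (0 < IZR n) by now apply IZR_lt.
  destruct (exp_opp_small (2 * PI * IZR n) eps) as [Y HY]; [nra|exact Heps|].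
  rewrite (H y (Rmax y Y)) by apply Rmax_l.
  eapply Rle_trans; [apply B|]. apply HY, Rmax_r.
- assert (IZR n < 0) by (apply IZR_lt; lia).
  destruct (exp_opp_small (- (2 * PI * IZR n)) eps) as [Y HY]; [nra|exact Heps|].
  pose proof (Rmin_r y (- Y)).
  rewrite <- (H (Rmin y (- Y)) y) by apply Rmin_l.
  eapply Rle_trans; [apply B|].
  replace (2 * PI * IZR n * Rmin y (- Y)) with (- (2 * PI * IZR n) * - Rmin y (- Y)) by ring.
  apply HY. lra.
Qed.

Fixpoint Csum (u : nat -> C) (N : nat) : C :=
  match N with O => RtoC 0 | S m => (Csum u m + u m)%C end.

Lemma period_mean_Csum (u : nat -> C -> C) y N :
  (forall n, ex_period_mean (u n) y) ->
  ex_period_mean (fun z => Csum (fun n => u n z) N) y /\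
  period_mean (fun z => Csum (fun n => u n z) N) y = Csum (fun n => period_mean (u n) y) N.
Proof.
intros H. induction N as [|N [IH1 IH2]]; simpl.
- split; [apply ex_CInt_const|apply period_mean_const].
- split; [now apply ex_period_mean_plus|]. rewrite period_mean_plus, IH2; auto.
Qed.

Lemma Csum_ext (u v : nat -> C) N : (forall n, (n < N)%nat -> u n = v n) -> Csum u N = Csum v N.
Proof.
induction N as [|N IH]; intros H; simpl; [reflexivity|].
rewrite IH, (H N); auto.
Qed.

Lemma Csum_mult c (u : nat -> C) N : Csum (fun n => c * u n)%C N = (c * Csum u N)%C.
Proof. induction N as [|N IH]; simpl; [|rewrite IH]; ring. Qed.

Lemma Csum_S (u : nat -> C) N : Csum u (S N) = (u 0%nat + Csum (fun n => u (S n)) N)%C.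
Proof. induction N as [|N IH]; [simpl; ring|]. simpl in *. rewrite IH. ring. Qed.

Lemma geometric_sum (x : C) N : (x - 1)%C <> 0%C ->
  (/ (1 - x) = Csum (fun n => x ^ n) N + x ^ N / (1 - x))%C.
Proof.
intros H.
assert (H' : (1 - x)%C <> 0%C).
{ intros E. apply H. replace (x - 1)%C with (- (1 - x))%C by ring. rewrite E. ring. }
induction N as [|N IH]; [simpl; field; exact H'|].
rewrite IH. cbn [Csum]. rewrite Cpow_S. field. exact H'.
Qed.

Lemma Cmod_triangle_rev (z w : C) : Cmod z - Cmod w <= Cmod (z - w).
Proof.
pose proof (Cmod_triangle (z - w) w) as H. replace (z - w + w)%C with z in H by ring. lra.
Qed.

(** * Cauchy's formula and Fourier series for periodic functions *)

(** L'Hospital's rule, needed to extend the Cauchy quotient continuously. *)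
Lemma cderiv_ratio f g z l m :
  cderiv f z l -> cderiv g z m -> f z = 0%C -> g z = 0%C -> m <> 0%C ->
  forall eps, 0 < eps -> exists d, 0 < d /\ forall w, Cmod (w - z) < d -> w <> z ->
    g w <> 0%C /\ Cmod (f w / g w - l / m) <= eps.
Proof.
intros Hf Hg Hf0 Hg0 Hm eps Heps.
assert (Hm' := proj1 (Cmod_gt_0 m) Hm). pose proof (Cmod_ge_0 l) as Hl.
set (M := Cmod m) in *. set (L := Cmod l) in *.
set (e := Rmin (M / 2) (eps * (M * M / 2) / (M + L))).
assert (Hq : 0 < eps * (M * M / 2) / (M + L)).
{ apply Rdiv_lt_0_compat; [|lra]. apply Rmult_lt_0_compat; nra. }
assert (He : 0 < e) by (apply Rmin_glb_lt; lra).
assert (He1 : e <= M / 2) by apply Rmin_l.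
assert (He2 : e * (M + L) <= eps * (M * M / 2)).
{ apply Rle_trans with (eps * (M * M / 2) / (M + L) * (M + L)).
  - apply Rmult_le_compat_r; [lra|apply Rmin_r].
  - right. field. lra. }
destruct (proj1 (cderiv_eps _ _ _) Hf e He) as [d1 [Hd1 H1]].
destruct (proj1 (cderiv_eps _ _ _) Hg e He) as [d2 [Hd2 H2]].
exists (Rmin d1 d2). split; [now apply Rmin_glb_lt|].
intros w Hw Hwz.
specialize (H1 w ltac:(eapply Rlt_le_trans; [exact Hw|apply Rmin_l])).
specialize (H2 w ltac:(eapply Rlt_le_trans; [exact Hw|apply Rmin_r])).
rewrite Hf0 in H1. rewrite Hg0 in H2.
set (h := (w - z)%C) in *.
assert (Hh : 0 < Cmod h) by (apply Cmod_gt_0, Cminus_eq_contra, Hwz).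
set (r := (f w - 0 - l * h)%C) in *. set (s := (g w - 0 - m * h)%C) in *.
assert (Ef : f w = (l * h + r)%C) by (unfold r; ring).
assert (Eg : g w = (m * h + s)%C) by (unfold s; ring).
assert (Hgw : M * Cmod h / 2 <= Cmod (g w)).
{ rewrite Eg. replace (m * h + s)%C with (m * h - - s)%C by ring.
  eapply Rle_trans; [|apply Cmod_triangle_rev]. rewrite Cmod_opp, Cmod_mult. fold M. nra. }
assert (Hg1 : 0 < Cmod (g w)) by nra.
assert (Hgn : g w <> 0%C) by now apply Cmod_gt_0.
split; [exact Hgn|].
replace (f w / g w - l / m)%C with ((m * r - l * s) / (m * g w))%C.
2: { unfold r, s. field. now split. }
rewrite Cmod_div by now apply Cmult_neq_0. rewrite Cmod_mult. fold M.
apply (Rmult_le_reg_r (M * Cmod (g w))); [nra|].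
unfold Rdiv. rewrite Rmult_assoc, Rinv_l, Rmult_1_r by nra.
assert (N1 : Cmod (m * r - l * s) <= (M + L) * (e * Cmod h)).
{ replace (m * r - l * s)%C with (m * r + - (l * s))%C by ring.
  eapply Rle_trans; [apply Cmod_triangle|]. rewrite Cmod_opp, !Cmod_mult. fold M L.
  nra. }
apply Rle_trans with (eps * (M * (M * Cmod h / 2))).
- eapply Rle_trans; [exact N1|]. nra.
- apply Rmult_le_compat_l; [lra|]. apply Rmult_le_compat_l; lra.
Qed.

Lemma expi_1_integer x : expi 1 (RtoC x) = 1%C -> exists k, x = IZR k.
Proof.
intros H. assert (E : cos (2 * (PI * x)) = 1).
{ unfold expi, Cexp in H. apply (f_equal fst) in H.
  unfold ZtoC, Ci, Cmult, RtoC, Re, Im in H; simpl in H.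
  replace (((2 * PI * 0 - 0 * 1) * 1 - (2 * PI * 1 + 0 * 0) * 0) * x -
   ((2 * PI * 0 - 0 * 1) * 0 + (2 * PI * 1 + 0 * 0) * 1) * 0) with 0 in H by ring.
  rewrite exp_0 in H. rewrite <- H.
  match goal with |- cos ?a = 1 * cos ?b - _ => replace b with a by ring end. ring. }
rewrite cos_2a_sin in E.
assert (S : sin (PI * x) = 0) by nra.
apply sin_eq_0_0 in S. destruct S as [k Hk]. exists k.
pose proof PI_RGT_0. nra.
Qed.

Definition periodic_above (Y : R) (F : C -> C) : Prop :=
  forall z, Y < Im z -> F (z + 1)%C = F z.

Lemma periodic_above_Z Y F z (k : Z) : periodic_above Y F -> Y < Im z ->
  F (z + RtoC (IZR k))%C = F z.
Proof.
intros Hp.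
assert (Hn : forall n w, Y < Im w -> F (w + RtoC (INR n))%C = F w).
{ induction n as [|n IH]; intros w Hw.
  - simpl. f_equal. ring.
  - rewrite S_INR, RtoC_plus, Cplus_assoc, Hp.
    + now apply IH.
    + destruct w as [a b]; simpl in *. lra. }
intros Hz. destruct (Z_le_gt_dec 0 k).
- rewrite <- (Z2Nat.id k), <- INR_IZR_INZ by lia. now apply Hn.
- rewrite <- (Hn (Z.to_nat (- k)) (z + RtoC (IZR k))%C).
  + f_equal. rewrite INR_IZR_INZ, Z2Nat.id, opp_IZR, RtoC_opp by lia. ring.
  + destruct z as [a b]; simpl in *. lra.
Qed.

(** [F] is holomorphic of period 1 above height [Y0]; the point [t0] at which its
    Fourier series is evaluated is fixed later, with [v] its height. *)
Section Strip.
Variables (Y0 : R) (F : C -> C).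
Hypothesis Fdiff : forall z, Y0 < Im z -> cdiff F z.
Hypothesis Fper : periodic_above Y0 F.

Definition fourier_coef (G : C -> C) (n : Z) (y : R) : C :=
  period_mean (fun z => G z * expi (- n) z)%C y.

Lemma periodic_line y : Y0 < y -> F (1, y) = F (0, y).
Proof.
intros Hy. rewrite <- (Fper (0, y)) by exact Hy. f_equal.
apply injective_projections; simpl; ring.
Qed.

Lemma fourier_coef_shift n y1 y2 : Y0 < y1 -> Y0 < y2 -> fourier_coef F n y1 = fourier_coef F n y2.
Proof.
assert (H : forall u v, Y0 < u -> u <= v -> fourier_coef F n u = fourier_coef F n v).
{ intros u v Hu Huv. apply period_mean_shift; [exact Huv| |].
  - intros z Hz. apply cdiff_mult; [apply Fdiff; lra|apply cdiff_expi].
  - intros y Hy. rewrite periodic_line, expi_period_pair by lra. reflexivity. }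
intros H1 H2. destruct (Rle_dec y1 y2).
- now apply H.
- symmetry. apply H; lra.
Qed.

Variable t0 : C.
Hypothesis Ht0 : Y0 < Im t0.
Let v := Im t0.

(** The value where the denominator vanishes is the limit, which makes the
    quotient continuous there. *)
Definition Cauchy_quotient (t : C) : C :=
  if Ceq_dec (expi 1 (t - t0)) 1
  then (C_derive F t / (RtoC (2 * PI) * Ci))%C
  else ((F t - F t0) / (expi 1 (t - t0) - 1))%C.

Lemma expi_ne_1 t : Im t <> v -> expi 1 (t - t0) <> 1%C.
Proof.
intros Ht E. apply (f_equal Cmod) in E.
rewrite Cmod_expi, Cmod_1 in E. apply (eq_trans (y := 1)) with (z := exp 0) in E; [|now rewrite exp_0]. apply exp_inv in E.
pose proof PI_RGT_0. apply Ht. apply (Rmult_eq_reg_l (2 * PI)); [|lra].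
unfold v, Cminus, Cplus, Copp, Im in *; cbn [fst snd] in E. lra.
Qed.

Lemma expi_ne_1_minus t : expi 1 (t - t0) <> 1%C -> (expi 1 (t - t0) - 1)%C <> 0%C.
Proof. apply Cminus_eq_contra. Qed.

Lemma cdiff_expi_shift t : cdiff (fun w => expi 1 (w - t0) - 1)%C t.
Proof.
apply cdiff_minus; [|apply cdiff_const].
apply (cdiff_comp (expi 1) (fun w => w - t0)%C); [apply cdiff_expi|].
apply cdiff_minus; [apply cdiff_id|apply cdiff_const].
Qed.

Lemma cdiff_quotient t : Y0 < Im t -> expi 1 (t - t0) <> 1%C -> cdiff Cauchy_quotient t.
Proof.
intros Ht Hne.
apply cdiff_ext_loc with (fun t => (F t - F t0) * / (expi 1 (t - t0) - 1))%C.
- apply locally_Cmod.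
  assert (Hm := proj1 (Cmod_gt_0 _) (expi_ne_1_minus t Hne)).
  destruct (cdiff_continuous _ _ (cdiff_expi_shift t) _ Hm) as [d [Hd H]].
  exists d. split; [exact Hd|]. intros w Hw. unfold Cauchy_quotient.
  destruct (Ceq_dec (expi 1 (w - t0)) 1) as [E|E]; [|reflexivity].
  exfalso. specialize (H w Hw). rewrite E in H.
  replace (1 - 1 - (expi 1 (t - t0) - 1))%C with (- (expi 1 (t - t0) - 1))%C in H by ring.
  rewrite Cmod_opp in H. lra.
- apply cdiff_mult.
  + apply cdiff_minus; [now apply Fdiff|apply cdiff_const].
  + apply cdiff_inv; [apply cdiff_expi_shift|now apply expi_ne_1_minus].
Qed.

Lemma two_pi_i_nz : (RtoC (2 * PI) * Ci)%C <> 0%C.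
Proof.
apply Cmult_neq_0; [|exact Ci_nz]. intros E. apply RtoC_inj in E. pose proof PI_RGT_0. lra.
Qed.

(** A zero of the denominator at height [v] differs from [t0] by an integer, so
    the numerator vanishes there as well. *)
Lemma C_continuous_quotient t : Im t = v -> C_continuous Cauchy_quotient t.
Proof.
intros Ht. assert (Ht' : Y0 < Im t) by (rewrite Ht; exact Ht0).
destruct (Ceq_dec (expi 1 (t - t0)) 1) as [E|E].
2: { unfold C_continuous. apply cdiff_continuous, cdiff_quotient; assumption. }
assert (EF : F t = F t0).
{ destruct (expi_1_integer (Re t - Re t0)) as [k Hk].
  - rewrite <- E. f_equal. destruct t as [a b]. unfold v in Ht.
    destruct t0 as [c e]. simpl in *. subst b. unfold RtoC; apply injective_projections; simpl; ring.
  - rewrite <- (periodic_above_Z Y0 F t0 k Fper Ht0). f_equal.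
    destruct t as [a b]. unfold v in Ht. destruct t0 as [c e]. simpl in *. subst b.
    unfold RtoC; apply injective_projections; simpl; lra. }
intros eps Heps.
assert (Df : cderiv (fun w => F w - F t0)%C t (C_derive F t - 0)%C).
{ apply cderiv_minus; [|apply cderiv_const]. apply C_derive_correct; [exact t|]. now apply Fdiff. }
assert (Dg : cderiv (fun w => expi 1 (w - t0) - 1)%C t (RtoC (2 * PI) * Ci)).
{ eapply cderiv_eq.
  - apply cderiv_minus; [|apply cderiv_const].
    apply (cderiv_comp (expi 1) (fun w => w - t0)%C); [apply cderiv_expi|].
    apply cderiv_minus; [apply cderiv_id|apply cderiv_const].
  - rewrite E. unfold ZtoC. ring. }
destruct (cderiv_ratio _ _ _ _ _ Df Dg) with (eps := eps / 2) as [d [Hd H]].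
- rewrite EF. ring.
- rewrite E. ring.
- exact two_pi_i_nz.
- lra.
- exists d. split; [exact Hd|]. intros w Hw.
  destruct (Ceq_dec w t) as [->|Hwt].
  { replace (Cauchy_quotient t - Cauchy_quotient t)%C with (RtoC 0) by ring. rewrite Cmod_0. exact Heps. }
  destruct (H w Hw Hwt) as [H1 H2].
  unfold Cauchy_quotient.
  destruct (Ceq_dec (expi 1 (w - t0)) 1) as [E1|E1].
  { exfalso. apply H1. rewrite E1. ring. }
  destruct (Ceq_dec (expi 1 (t - t0)) 1) as [_|E2]; [|contradiction].
  replace (C_derive F t - 0)%C with (C_derive F t) in H2 by ring. lra.
Qed.

Lemma quotient_period_line y : Y0 < y -> y <> v -> Cauchy_quotient (1, y) = Cauchy_quotient (0, y).
Proof.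
intros Hy Hyv.
assert (E : expi 1 ((1, y) - t0) = expi 1 ((0, y) - t0)).
{ rewrite <- (expi_period 1 ((0, y) - t0)). f_equal. apply injective_projections; simpl; ring. }
unfold Cauchy_quotient. rewrite E, periodic_line by exact Hy.
destruct (Ceq_dec (expi 1 ((0, y) - t0)) 1) as [K|K]; [|reflexivity].
exfalso. revert K. apply expi_ne_1. exact Hyv.
Qed.

Lemma period_mean_quotient_side y1 y2 : Y0 < y1 -> y1 <= y2 -> (y2 < v \/ v < y1) ->
  period_mean Cauchy_quotient y1 = period_mean Cauchy_quotient y2.
Proof.
intros H1 H12 Hs. apply period_mean_shift; [exact H12| |].
- intros z Hz. apply cdiff_quotient; [lra|]. apply expi_ne_1. lra.
- intros y Hy. apply quotient_period_line; lra.
Qed.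

Lemma ex_period_mean_quotient y : Y0 < y -> y <> v -> ex_period_mean Cauchy_quotient y.
Proof.
intros Hy Hyv. apply ex_period_mean_diff. intros x. apply cdiff_quotient; [exact Hy|].
now apply expi_ne_1.
Qed.

(** Below height [v] the mean of the quotient is constant, and it tends to the
    mean at height [v] itself; [period_mean_quotient_high] is the same from
    above.  Together they carry the mean across [t0]. *)
Lemma period_mean_quotient_low y : Y0 < y -> y < v -> period_mean Cauchy_quotient y = period_mean Cauchy_quotient v.
Proof.
intros Hy Hyv. apply Cmod_eps_eq. intros eps Heps.
destruct (period_mean_continuous Cauchy_quotient v) with (eps := eps) as [d [Hd H]];
  [intros; now apply C_continuous_quotient|exact Heps|].
set (u := Rmax y (v - d / 2)).
assert (y <= u) by apply Rmax_l. assert (v - d / 2 <= u) by apply Rmax_r.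
assert (u < v) by (apply Rmax_lub_lt; lra).
rewrite (period_mean_quotient_side y u) by lra.
apply H; [apply Rabs_def1; lra|apply ex_period_mean_quotient; lra].
Qed.

Lemma period_mean_quotient_high y : v < y -> period_mean Cauchy_quotient y = period_mean Cauchy_quotient v.
Proof.
intros Hyv. apply Cmod_eps_eq. intros eps Heps.
destruct (period_mean_continuous Cauchy_quotient v) with (eps := eps) as [d [Hd H]];
  [intros; now apply C_continuous_quotient|exact Heps|].
set (u := Rmin y (v + d / 2)).
assert (u <= y) by apply Rmin_l. assert (u <= v + d / 2) by apply Rmin_r.
assert (v < u) by (apply Rmin_glb_lt; lra).
assert (Y0 < v) by exact Ht0.
rewrite <- (period_mean_quotient_side u y) by lra.
apply H; [apply Rabs_def1; lra|apply ex_period_mean_quotient; lra].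
Qed.

Lemma ex_fourier_coef G n y : (forall z, Im z = y -> cdiff G z) -> ex_period_mean (fun z => G z * expi n z)%C y.
Proof.
intros H. apply ex_period_mean_diff. intros x. apply cdiff_mult; [now apply H|apply cdiff_expi].
Qed.

Lemma fourier_coef_minus_const G c n y : (forall z, Im z = y -> cdiff G z) ->
  fourier_coef (fun z => G z - c)%C n y = (fourier_coef G n y - (if Z.eq_dec n 0 then c else 0))%C.
Proof.
intros H. unfold fourier_coef.
rewrite (period_mean_ext _ (fun z => G z * expi (- n) z - c * expi (- n) z)%C) by (intros; ring).
rewrite period_mean_minus, period_mean_Cmult.
- f_equal. f_equal. destruct (Z.eq_dec n 0) as [->|Hn].
  + rewrite (period_mean_ext _ (fun _ => 1%C)) by (intros; apply expi_0). rewrite period_mean_const. ring.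
  + rewrite period_mean_expi by lia. ring.
- apply ex_period_mean_diff; intros; apply cdiff_expi.
- now apply ex_fourier_coef.
- apply ex_period_mean_Cmult, ex_period_mean_diff; intros; apply cdiff_expi.
Qed.

(** High up, [expi 1 (t - t0)] tends to 0 and the quotient to [- (F t - F t0)],
    uniformly because [F] is bounded there. *)
Lemma period_mean_quotient_high_value (Y1 M1 : R) :
  (forall z, Y1 < Im z -> Cmod (F z) <= M1) ->
  period_mean Cauchy_quotient v = (F t0 - fourier_coef F 0 v)%C.
Proof.
intros HM.
assert (HM1 : 0 <= M1).
{ eapply Rle_trans; [apply Cmod_ge_0|]. apply (HM (0, Y1 + 1)). simpl. lra. }
apply Cmod_eps_eq. intros eps Heps.
pose proof PI_RGT_0 as Hpi.
set (C0 := M1 + Cmod (F t0)).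
assert (HC0 : 0 <= C0) by (pose proof (Cmod_ge_0 (F t0)); unfold C0; lra).
set (e := Rmin (1 / 2) (eps / (2 * (C0 + 1)))).
assert (He : 0 < e).
{ apply Rmin_glb_lt; [lra|]. apply Rdiv_lt_0_compat; lra. }
assert (He1 : e <= 1 / 2) by apply Rmin_l.
assert (He2 : C0 * (2 * e) <= eps).
{ assert (K : e <= eps / (2 * (C0 + 1))) by apply Rmin_r.
  apply (Rmult_le_compat_r (2 * (C0 + 1))) in K; [|lra].
  replace (eps / (2 * (C0 + 1)) * (2 * (C0 + 1))) with eps in K by (field; lra). nra. }
destruct (exp_opp_small (2 * PI) e ltac:(lra) He) as [Y HY].
set (y := Rmax (Rmax Y 0 + v) Y1 + 1).
pose proof (Rmax_l (Rmax Y 0 + v) Y1). pose proof (Rmax_r (Rmax Y 0 + v) Y1).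
pose proof (Rmax_l Y 0). pose proof (Rmax_r Y 0).
assert (Hyv : v < y) by (unfold y; lra).
assert (Hv : Y0 < v) by exact Ht0.
rewrite <- (period_mean_quotient_high y Hyv).
rewrite (fourier_coef_shift 0 v y) by lra.
assert (Hd : forall z, Im z = y -> cdiff F z) by (intros z Hz; apply Fdiff; lra).
assert (E : (F t0 - fourier_coef F 0 y)%C = period_mean (fun z => - (1) * (F z - F t0))%C y).
{ rewrite period_mean_Cmult, period_mean_minus, period_mean_const.
  - unfold fourier_coef. rewrite (period_mean_ext (fun z => F z * expi (- 0) z)%C F); [ring|].
    intros x. change (- 0)%Z with 0%Z. rewrite expi_0. ring.
  - apply ex_period_mean_diff. intros; now apply Hd.
  - apply ex_CInt_const.
  - apply ex_period_mean_minus; [apply ex_period_mean_diff; intros; now apply Hd|apply ex_CInt_const]. }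
rewrite E, <- period_mean_minus.
2: apply ex_period_mean_quotient; lra.
2: { apply ex_period_mean_Cmult, ex_period_mean_minus; [apply ex_period_mean_diff; intros; now apply Hd|apply ex_CInt_const]. }
apply Cmod_period_mean_le.
{ apply ex_period_mean_minus; [apply ex_period_mean_quotient; lra|].
  apply ex_period_mean_Cmult, ex_period_mean_minus; [apply ex_period_mean_diff; intros; now apply Hd|apply ex_CInt_const]. }
intros x.
assert (Hne : expi 1 ((x, y) - t0) <> 1%C) by (apply expi_ne_1; simpl; lra).
assert (Hne' := expi_ne_1_minus _ Hne).
unfold Cauchy_quotient. destruct (Ceq_dec (expi 1 ((x, y) - t0)) 1) as [K|_]; [contradiction|].
set (q := expi 1 ((x, y) - t0)) in *.
replace ((F (x, y) - F t0) / (q - 1) - - (1) * (F (x, y) - F t0))%C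
  with ((F (x, y) - F t0) * (q / (q - 1)))%C by (field; exact Hne').
assert (Hq : Cmod q <= e).
{ unfold q. rewrite Cmod_expi.
  replace (2 * PI * 1 * Im ((x, y) - t0)) with (2 * PI * (y - v)) by (unfold v, Im; simpl; ring).
  apply HY. unfold y. lra. }
assert (Hq1 : 1 / 2 <= Cmod (q - 1)).
{ replace (q - 1)%C with (- (1 - q))%C by ring. rewrite Cmod_opp.
  pose proof (Cmod_triangle_rev 1 q). rewrite Cmod_1 in *. lra. }
rewrite Cmod_mult, Cmod_div by exact Hne'.
eapply Rle_trans; [|exact He2]. apply Rmult_le_compat; try apply Cmod_ge_0.
- apply Rdiv_le_0_compat; [apply Cmod_ge_0|lra].
- replace (F (x, y) - F t0)%C with (F (x, y) + - F t0)%C by ring.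
  eapply Rle_trans; [apply Cmod_triangle|]. rewrite Cmod_opp.
  unfold C0. apply Rplus_le_compat_r. apply HM. simpl. unfold y. lra.
- apply (Rmult_le_reg_r (Cmod (q - 1))); [lra|].
  unfold Rdiv. rewrite Rmult_assoc, Rinv_l, Rmult_1_r by lra.
  pose proof (Cmod_ge_0 q). nra.
Qed.

(** Above, the mean of the quotient is [F t0] minus the constant coefficient.
    Below [t0], the kernel is a geometric series in [rho], whose terms give
    the other coefficients.  The factor [M + Cmod (F t0)] bounds the numerator
    [F t - F t0], and [1 / (1 - rho)] the kernel. *)
Theorem fourier_partial_sum (Y1 M1 y M : R) (N : nat) :
  (forall z, Y1 < Im z -> Cmod (F z) <= M1) ->
  Y0 < y -> y < v -> (forall x, 0 <= x <= 1 -> Cmod (F (x, y)) <= M) ->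
  let rho := exp (- (2 * PI * (v - y))) in
  Cmod (F t0 - Csum (fun n => fourier_coef F (Z.of_nat n) y * expi (Z.of_nat n) t0)%C N)
    <= (M + Cmod (F t0)) / (1 - rho) * rho ^ N.
Proof.
intros HM1 Hy Hyv HM rho.
pose proof PI_RGT_0 as Hpi.
assert (Hv : Y0 < v) by exact Ht0.
assert (Hrho : 0 < rho < 1).
{ split; [apply exp_pos|]. rewrite <- exp_0. apply exp_increasing. nra. }
assert (HM0 : 0 <= M) by (eapply Rle_trans; [apply Cmod_ge_0|apply (HM 0); lra]).
pose proof (Cmod_ge_0 (F t0)) as HF0.
destruct N as [|N].
{ simpl. replace (F t0 - 0)%C with (F t0) by ring. rewrite Rmult_1_r.
  apply (Rmult_le_reg_r (1 - rho)); [lra|].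
  unfold Rdiv. rewrite Rmult_assoc, Rinv_l by lra. nra. }
rewrite Csum_S.
replace (fourier_coef F (Z.of_nat 0) y * expi (Z.of_nat 0) t0)%C with (fourier_coef F 0 v).
2: { simpl. rewrite expi_0, (fourier_coef_shift 0 v y) by lra. ring. }
assert (E := period_mean_quotient_high_value Y1 M1 HM1).
assert (Hd : forall z, Im z = y -> cdiff F z) by (intros z Hz; apply Fdiff; lra).
assert (Hd1 : forall z, Im z = y -> cdiff (fun z => F z - F t0)%C z).
{ intros z Hz. apply cdiff_minus; [now apply Hd|apply cdiff_const]. }
rewrite <- (period_mean_quotient_low y) in E by lra.
(* The [n]-th term of the geometric series, as a function of the point [z] of
   the lower line; its mean is a Fourier coefficient of [F], from which the
   constant [F t0] disappears as [S n] is not 0. *)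
set (u := fun (n : nat) (z : C) => (expi (Z.of_nat (S n)) t0 * ((F z - F t0) * expi (- Z.of_nat (S n)) z))%C).
assert (Hu : forall n, ex_period_mean (u n) y).
{ intros n. apply ex_period_mean_Cmult, ex_fourier_coef, Hd1. }
destruct (period_mean_Csum u y N Hu) as [ES1 ES2].
assert (EU : Csum (fun n => fourier_coef F (Z.of_nat (S n)) y * expi (Z.of_nat (S n)) t0)%C N
   = period_mean (fun z => Csum (fun n => u n z) N) y).
{ rewrite ES2. apply Csum_ext. intros n _. unfold u.
  rewrite period_mean_Cmult by apply ex_fourier_coef, Hd1.
  change (period_mean (fun z => (F z - F t0) * expi (- Z.of_nat (S n)) z)%C y)
    with (fourier_coef (fun z => F z - F t0)%C (Z.of_nat (S n)) y).
  rewrite fourier_coef_minus_const by exact Hd.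
  destruct (Z.eq_dec (Z.of_nat (S n)) 0); [lia|]. ring. }
rewrite EU.
replace (F t0 - (fourier_coef F 0 v + period_mean (fun z => Csum (fun n => u n z) N) y))%C
  with (period_mean Cauchy_quotient y - period_mean (fun z => Csum (fun n => u n z) N) y)%C
  by (rewrite E; ring).
assert (EQ : ex_period_mean Cauchy_quotient y) by (apply ex_period_mean_quotient; lra).
rewrite <- (period_mean_minus Cauchy_quotient (fun z => Csum (fun n => u n z) N) y EQ ES1).
unfold period_mean. replace ((M + Cmod (F t0)) / (1 - rho) * rho ^ S N)
  with ((M + Cmod (F t0)) / (1 - rho) * rho ^ S N * (1 - 0)) by ring.
apply Cmod_CInt_le; [lra| |].
{ exact (ex_period_mean_minus _ _ y EQ ES1). }
intros x Hx.
assert (Hne : expi 1 ((x, y) - t0) <> 1%C) by (apply expi_ne_1; simpl; lra).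
assert (Hne' := expi_ne_1_minus _ Hne).
unfold Cauchy_quotient. destruct (Ceq_dec (expi 1 ((x, y) - t0)) 1) as [K|_]; [contradiction|].
set (q := expi 1 (t0 - (x, y))).
assert (Hq : Cmod q = rho).
{ unfold q, rho. rewrite Cmod_expi. apply (f_equal exp). unfold v, Im; simpl; ring. }
assert (Hqe : expi 1 ((x, y) - t0) = (/ q)%C).
{ unfold q. rewrite <- expi_neg. f_equal. ring. }
assert (Hq0 : q <> 0%C) by apply expi_nz.
assert (Hq1 : (q - 1)%C <> 0%C).
{ intros K. apply Hne. rewrite Hqe. replace q with (1 + (q - 1))%C by ring. rewrite K. field. }
assert (Hq1' : (1 - q)%C <> 0%C).
{ intros K. apply Hq1. replace (q - 1)%C with (- (1 - q))%C by ring. rewrite K. ring. }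
rewrite Hqe.
replace ((F (x, y) - F t0) / (/ q - 1))%C with ((F (x, y) - F t0) * q * / (1 - q))%C.
2: { field. repeat split; try assumption. }
rewrite (geometric_sum q N Hq1).
assert (Eu : Csum (fun n => u n (x, y)) N = ((F (x, y) - F t0) * q * Csum (fun n => q ^ n) N)%C).
{ rewrite <- Csum_mult. apply Csum_ext. intros n _. unfold u.
  replace (q ^ n)%C with (q ^ n * q / q)%C by (field; exact Hq0).
  replace ((F (x, y) - F t0) * q * (q ^ n * q / q))%C with ((F (x, y) - F t0) * (q * q ^ n))%C by (field; exact Hq0).
  rewrite <- Cpow_S. unfold q. rewrite <- expi_1_pow.
  replace (t0 - (x, y))%C with (t0 + - (x, y))%C by ring.
  rewrite expi_add, expi_neg, expi_opp. ring. }
rewrite Eu.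
replace ((F (x, y) - F t0) * q * (Csum (fun n => q ^ n) N + q ^ N / (1 - q))
  - (F (x, y) - F t0) * q * Csum (fun n => q ^ n) N)%C
  with ((F (x, y) - F t0) * (q * q ^ N / (1 - q)))%C by (field; exact Hq1').
rewrite <- Cpow_S, Cmod_mult, Cmod_div, Cmod_pow, Hq by exact Hq1'.
unfold Rdiv. rewrite (Rmult_assoc (M + _)).
apply Rmult_le_compat; try apply Cmod_ge_0.
- apply Rmult_le_pos; [apply pow_le; lra|]. apply Rlt_le, Rinv_0_lt_compat.
  now apply Cmod_gt_0.
- replace (F (x, y) - F t0)%C with (F (x, y) + - F t0)%C by ring.
  eapply Rle_trans; [apply Cmod_triangle|]. rewrite Cmod_opp.
  apply Rplus_le_compat_r. now apply HM.
- rewrite Rmult_comm. apply Rmult_le_compat_r; [apply pow_le; lra|].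
  apply Rinv_le_contravar; [lra|].
  pose proof (Cmod_triangle_rev 1 q). rewrite Cmod_1 in *. lra.
Qed.

End Strip.

(** * Taylor expansions *)

Lemma exists_angle x y : x * x + y * y = 1 -> exists t, cos t = x /\ sin t = y.
Proof.
intros H.
assert (Hx : -1 <= x <= 1) by nra.
assert (Hs : sqrt (1 - Rsqr x) = Rabs y).
{ replace (1 - Rsqr x) with (Rsqr y) by (unfold Rsqr; lra). apply sqrt_Rsqr_abs. }
destruct (Rle_dec 0 y) as [Hy|Hy].
- exists (acos x). rewrite cos_acos, sin_acos, Hs, Rabs_pos_eq by lra. auto.
- exists (- acos x). rewrite cos_neg, sin_neg, cos_acos, sin_acos, Hs, Rabs_left by lra.
  split; ring.
Qed.

Lemma expi_surj (q : C) : q <> 0%C ->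
  exists t, expi 1 t = q /\ Im t = - ln (Cmod q) / (2 * PI).
Proof.
intros Hq. assert (Hm := proj1 (Cmod_gt_0 q) Hq).
destruct q as [a b].
destruct (exists_angle (a / Cmod (a, b)) (b / Cmod (a, b))) as [th [Hc Hs]].
{ apply (Rmult_eq_reg_r (Cmod (a, b) * Cmod (a, b))); [|nra].
  rewrite Rmult_1_l. replace (Cmod (a, b) * Cmod (a, b)) with (a * a + b * b) at 2.
  - field. lra.
  - unfold Cmod; cbn [fst snd]. rewrite sqrt_sqrt; nra. }
pose proof PI_RGT_0.
exists (th / (2 * PI), - ln (Cmod (a, b)) / (2 * PI)). split; [|reflexivity].
unfold expi.
replace (RtoC (2 * PI) * Ci * ZtoC 1 * ((th / (2 * PI))%R, (- ln (Cmod (a, b)) / (2 * PI))%R))%C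
  with ((ln (Cmod (a, b)), th) : C).
2: { unfold ZtoC, Ci, Cmult, RtoC; apply injective_projections; simpl; field; lra. }
unfold Cexp, Re, Im; cbn [fst snd]. rewrite exp_ln, Hc, Hs by exact Hm.
unfold Cmult, RtoC; apply injective_projections; cbn [fst snd]; field; lra.
Qed.

Lemma Csum_at_0 (A : nat -> C) N : Csum (fun n => A n * 0 ^ n)%C (S N) = A 0%nat.
Proof.
rewrite Csum_S. rewrite (Csum_ext _ (fun n => 0 * (A (S n) * 0 ^ n))%C).
- rewrite Csum_mult. simpl. ring.
- intros n _. rewrite Cpow_S. ring.
Qed.

Definition circle (c : C) (r : R) (x : R) : C := (c + RtoC r * expi 1 (RtoC x))%C.

(** The function [t |-> h (c + expi 1 t)] is holomorphic of period 1 where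
    [expi 1 t] has modulus less than [R0], and it is bounded high up since [h] is
    continuous at [c]: its Fourier series is the Taylor series of [h].  The
    centre, which is no value of [c + expi 1 t], is reached by continuity. *)
Theorem taylor_estimate (h : C -> C) (c : C) (R0 r M : R) :
  0 < r < R0 -> (forall w, Cmod (w - c) < R0 -> cdiff h w) ->
  (forall x, 0 <= x <= 1 -> Cmod (h (circle c r x)) <= M) ->
  exists A : nat -> C, forall (q : C) (N : nat), Cmod q < r ->
    Cmod (h (c + q) - Csum (fun n => A n * q ^ n) N)%C
      <= (M + Cmod (h (c + q)%C)) / (1 - Cmod q / r) * (Cmod q / r) ^ N.
Proof.
intros Hr Hh HM.
pose proof PI_RGT_0 as Hpi.
set (F := fun t => h (c + expi 1 t)%C).
set (y := - ln r / (2 * PI)). set (Y0 := - ln R0 / (2 * PI)).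
assert (HM0 : 0 <= M) by (eapply Rle_trans; [apply Cmod_ge_0|apply (HM 0); lra]).
assert (Hln : forall a b, 0 < a -> a < b -> - ln b / (2 * PI) < - ln a / (2 * PI)).
{ intros a b Ha Hab. apply Rmult_lt_compat_r; [apply Rinv_0_lt_compat; lra|].
  apply Ropp_lt_contravar, ln_increasing; assumption. }
assert (Hexp : forall u t, 0 < u -> - ln u / (2 * PI) < Im t -> Cmod (expi 1 t) < u).
{ intros u t Hu Ht. rewrite Cmod_expi. rewrite <- (exp_ln u Hu) at 1. apply exp_increasing.
  apply (Rmult_lt_compat_r (2 * PI)) in Ht; [|lra].
  replace (- ln u / (2 * PI) * (2 * PI)) with (- ln u) in Ht by (field; lra). lra. }
assert (Hadd : forall w, (c + w - c)%C = w) by (intros w; ring).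
assert (Fdiff : forall z, Y0 < Im z -> cdiff F z).
{ intros z Hz. apply (cdiff_comp h (fun t => c + expi 1 t)%C).
  - apply Hh. rewrite Hadd. apply Hexp; [lra|exact Hz].
  - apply cdiff_plus; [apply cdiff_const|apply cdiff_expi]. }
assert (Fper : periodic_above Y0 F).
{ intros z _. unfold F. now rewrite expi_period. }
assert (HY : Y0 < y) by (apply Hln; lra).
assert (Hc : Cmod (c - c) < R0).
{ replace (c - c)%C with (RtoC 0) by ring. rewrite Cmod_0. lra. }
assert (Cc := cdiff_continuous h c (Hh c Hc)).
destruct (Cc 1 Rlt_0_1) as [d [Hd Hcd]].
assert (Fb : forall z, - ln d / (2 * PI) < Im z -> Cmod (F z) <= Cmod (h c) + 1).
{ intros z Hz. specialize (Hcd (c + expi 1 z)%C). rewrite Hadd in Hcd.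
  specialize (Hcd (Hexp d z Hd Hz)). unfold F.
  replace (h (c + expi 1 z)%C) with (h c + (h (c + expi 1 z)%C - h c))%C by ring.
  eapply Rle_trans; [apply Cmod_triangle|]. lra. }
assert (Fl : forall x, 0 <= x <= 1 -> Cmod (F (x, y)) <= M).
{ intros x Hx. unfold F.
  replace (expi 1 (x, y)) with (RtoC r * expi 1 (RtoC x))%C; [now apply HM|].
  replace ((x, y) : C) with ((0, y) + RtoC x)%C
    by (unfold RtoC; apply injective_projections; simpl; ring).
  rewrite expi_add. f_equal. unfold expi.
  replace (RtoC (2 * PI) * Ci * ZtoC 1 * (0, y))%C with (RtoC (ln r)).
  - unfold Cexp, RtoC, Re, Im; cbn [fst snd]. rewrite exp_ln, cos_0, sin_0 by lra.
    apply injective_projections; simpl; ring.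
  - unfold ZtoC, Ci, Cmult, RtoC, y; apply injective_projections; simpl; field; lra. }
set (A := fun n => fourier_coef F (Z.of_nat n) y).
assert (Hne : forall (q : C) N, q <> 0%C -> Cmod q < r ->
  Cmod (h (c + q) - Csum (fun n => A n * q ^ n) N)%C
      <= (M + Cmod (h (c + q)%C)) / (1 - Cmod q / r) * (Cmod q / r) ^ N).
{ intros q N Hq Hqr. assert (Hm := proj1 (Cmod_gt_0 q) Hq).
  destruct (expi_surj q Hq) as [t [Et It]].
  assert (Hyt : y < Im t) by (rewrite It; apply Hln; lra).
  assert (K := fourier_partial_sum Y0 F Fdiff Fper t ltac:(lra) (- ln d / (2 * PI)) (Cmod (h c) + 1) y M N
    Fb HY Hyt Fl). cbv zeta in K.
  replace (exp (- (2 * PI * (Im t - y)))) with (Cmod q / r) in K.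
  2: { rewrite It. unfold y.
       replace (- (2 * PI * (- ln (Cmod q) / (2 * PI) - - ln r / (2 * PI))))
         with (ln (Cmod q) + - ln r) by (field; lra).
       rewrite exp_plus, exp_Ropp, !exp_ln by lra. reflexivity. }
  assert (EF : F t = h (c + q)%C) by (unfold F; now rewrite Et).
  rewrite EF in K.
  rewrite (Csum_ext (fun n => A n * q ^ n)%C
     (fun n => fourier_coef F (Z.of_nat n) y * expi (Z.of_nat n) t)%C); [exact K|].
  intros n _. rewrite expi_1_pow, Et. reflexivity. }
(* Let a real [s > 0] tend to 0 in the estimate with a single term. *)
assert (HA0 : h c = A 0%nat).
{ apply Cmod_eps_eq. intros eps Heps.
  destruct (Cc (eps / 2) ltac:(lra)) as [d2 [Hd2 H2]].
  set (K := M + (Cmod (h c) + 1)).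
  assert (HK : 0 < K) by (unfold K; pose proof (Cmod_ge_0 (h c)); lra).
  set (s := Rmin (Rmin d d2 / 2) (Rmin (r / 2) (r * eps / (4 * K)))).
  assert (Hs : 0 < s).
  { repeat apply Rmin_glb_lt; try lra.
    - apply Rmult_lt_0_compat; [|lra]. now apply Rmin_glb_lt.
    - apply Rdiv_lt_0_compat; [|lra]. apply Rmult_lt_0_compat; lra. }
  assert (Hs1 : s <= Rmin d d2 / 2) by apply Rmin_l.
  assert (Hs23 : s <= Rmin (r / 2) (r * eps / (4 * K))) by apply Rmin_r.
  pose proof (Rmin_l (r / 2) (r * eps / (4 * K))). pose proof (Rmin_r (r / 2) (r * eps / (4 * K))).
  pose proof (Rmin_l d d2). pose proof (Rmin_r d d2).
  assert (Hms : Cmod (RtoC s) = s) by (rewrite Cmod_R; apply Rabs_pos_eq; lra).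
  specialize (Hne (RtoC s) 1%nat).
  rewrite Hms in Hne.
  assert (Hs0 : RtoC s <> 0%C) by (intros E; apply RtoC_inj in E; lra).
  specialize (Hne Hs0 ltac:(lra)).
  specialize (H2 (c + RtoC s)%C). rewrite Hadd, Hms in H2. specialize (H2 ltac:(lra)).
  specialize (Hcd (c + RtoC s)%C). rewrite Hadd, Hms in Hcd. specialize (Hcd ltac:(lra)).
  cbn [Csum] in Hne.
  replace (h (c + RtoC s)%C - (0 + A 0%nat * RtoC s ^ 0))%C with (h (c + RtoC s)%C - A 0%nat)%C in Hne
    by (simpl; ring).
  assert (Hhs : Cmod (h (c + RtoC s)%C) <= Cmod (h c) + 1).
  { replace (h (c + RtoC s)%C) with (h c + (h (c + RtoC s)%C - h c))%C by ring.
    eapply Rle_trans; [apply Cmod_triangle|]. lra. }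
  replace (h c - A 0%nat)%C with (- (h (c + RtoC s)%C - h c) + (h (c + RtoC s)%C - A 0%nat))%C by ring.
  eapply Rle_trans; [apply Cmod_triangle|]. rewrite Cmod_opp.
  assert (Hfin : (M + Cmod (h (c + RtoC s)%C)) / (1 - s / r) * (s / r) ^ 1 <= eps / 2); [|lra].
  rewrite pow_1.
  assert (Hsr : s / r <= 1 / 2).
  { apply (Rmult_le_reg_r r); [lra|]. unfold Rdiv at 1. rewrite Rmult_assoc, Rinv_l by lra. lra. }
  assert (Hsr0 : 0 < s / r) by (apply Rdiv_lt_0_compat; lra).
  apply Rle_trans with (K / (1 / 2) * (s / r)).
  + apply Rmult_le_compat_r; [lra|]. apply Rmult_le_compat.
    * pose proof (Cmod_ge_0 (h (c + RtoC s)%C)). lra.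
    * apply Rlt_le, Rinv_0_lt_compat. lra.
    * unfold K. lra.
    * apply Rinv_le_contravar; lra.
  + assert (Hsk : s <= r * eps / (4 * K)) by lra.
    apply (Rmult_le_compat_r (4 * K / r)) in Hsk; [|apply Rlt_le, Rdiv_lt_0_compat; lra].
    replace (r * eps / (4 * K) * (4 * K / r)) with eps in Hsk by (field; lra).
    replace (K / (1 / 2) * (s / r)) with (s * (4 * K / r) / 2) by (field; lra). lra. }
exists A. intros q N Hqr.
destruct (Ceq_dec q 0) as [->|Hq]; [|now apply Hne].
rewrite Cmod_0. replace (0 / r) with 0 by (field; lra).
replace (c + 0)%C with c by ring. pose proof (Cmod_ge_0 (h c)).
destruct N as [|N].
- simpl. replace (h c - 0)%C with (h c) by ring.
  rewrite Rminus_0_r, Rmult_1_r. unfold Rdiv. rewrite Rinv_1. lra.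
- rewrite Csum_at_0, <- HA0. replace (h c - h c)%C with (RtoC 0) by ring.
  rewrite Cmod_0, pow_i by lia. lra.
Qed.

Lemma circle_dist c r x : 0 <= r -> Cmod (circle c r x - c) = r.
Proof.
intros Hr. unfold circle. replace (c + RtoC r * expi 1 (RtoC x) - c)%C with (RtoC r * expi 1 (RtoC x))%C by ring.
rewrite Cmod_mult, Cmod_R, Cmod_expi, Rabs_pos_eq by exact Hr.
replace (- (2 * PI * 1 * Im (RtoC x))) with 0 by (unfold RtoC, Im; simpl; ring).
rewrite exp_0. ring.
Qed.

(** The constants do not depend on the centre [c'], which is what
    [cdiff_derive] needs in order to compare expansions at nearby centres. *)
Lemma taylor_locally (h : C -> C) (c : C) : locally c (cdiff h) ->
  exists rho K : R, 0 < rho /\ 0 <= K /\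
    forall c' : C, Cmod (c' - c) < rho -> cdiff h c' /\
    exists A : nat -> C, forall (q : C) (N : nat), Cmod q < rho ->
      Cmod (h (c' + q) - Csum (fun n => A n * q ^ n) N)%C
        <= K * (Cmod q / (2 * rho)) ^ N.
Proof.
intros H. apply locally_Cmod in H. destruct H as [d [Hd H]].
assert (Hc : cdiff h c).
{ apply H. replace (c - c)%C with (RtoC 0) by ring. now rewrite Cmod_0. }
destruct (cdiff_continuous h c Hc 1 Rlt_0_1) as [d' [Hd' H']].
set (R0 := Rmin d d'). assert (HR : 0 < R0) by now apply Rmin_glb_lt.
set (M := Cmod (h c) + 1).
assert (HM : forall w, Cmod (w - c) < R0 -> Cmod (h w) <= M).
{ intros w Hw. replace (h w) with (h c + (h w - h c))%C by ring.
  eapply Rle_trans; [apply Cmod_triangle|]. apply Rplus_le_compat_l, Rlt_le, H'.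
  eapply Rlt_le_trans; [exact Hw|apply Rmin_r]. }
assert (HM0 : 0 <= M) by (unfold M; pose proof (Cmod_ge_0 (h c)); lra).
assert (Hdiff : forall w, Cmod (w - c) < R0 -> cdiff h w).
{ intros w Hw. apply H. eapply Rlt_le_trans; [exact Hw|apply Rmin_l]. }
assert (Htri : forall w c', Cmod (w - c) <= Cmod (w - c') + Cmod (c' - c)).
{ intros w c'. replace (w - c)%C with ((w - c') + (c' - c))%C by ring. apply Cmod_triangle. }
(* Discs of radius [R0 / 2] around [c'] stay inside the disc of radius [R0];
   expanding on the circle of radius [R0 / 4] and using [Cmod q < R0 / 8] makes
   the ratio at most 1/2, and [(M + M) / (1 - 1/2) = 4 M]. *)
exists (R0 / 8), (4 * M). split; [lra|]. split; [lra|].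
intros c' Hc'. split; [apply Hdiff; lra|].
destruct (taylor_estimate h c' (R0 / 2) (R0 / 4) M) as [A HA].
- lra.
- intros w Hw. apply Hdiff. pose proof (Htri w c'). lra.
- intros x Hx. apply HM. pose proof (Htri (circle c' (R0 / 4) x) c') as T.
  rewrite circle_dist in T by lra. lra.
- exists A. intros q N Hq. eapply Rle_trans; [apply HA; lra|].
  replace (2 * (R0 / 8)) with (R0 / 4) by field.
  pose proof (Cmod_ge_0 q).
  assert (Hx : 0 <= Cmod q / (R0 / 4) <= 1 / 2).
  { split; [apply Rdiv_le_0_compat; lra|].
    apply (Rmult_le_reg_r (R0 / 4)); [lra|]. unfold Rdiv at 1. rewrite Rmult_assoc, Rinv_l by lra. lra. }
  apply Rmult_le_compat_r; [apply pow_le; lra|].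
  assert (Hh : Cmod (h (c' + q)%C) <= M).
  { apply HM. pose proof (Htri (c' + q)%C c') as T.
    replace (c' + q - c')%C with q in T by ring. lra. }
  replace (4 * M) with ((M + M) * / (1 / 2)) by field.
  pose proof (Cmod_ge_0 (h (c' + q)%C)).
  apply Rmult_le_compat; [lra| |lra|].
  + apply Rlt_le, Rinv_0_lt_compat; lra.
  + apply Rinv_le_contravar; lra.
Qed.

Lemma taylor_coef_0 (h : C -> C) c (A : nat -> C) rho K : 0 < rho ->
  (forall (q : C) (N : nat), Cmod q < rho ->
      Cmod (h (c + q) - Csum (fun n => A n * q ^ n) N)%C
        <= K * (Cmod q / (2 * rho)) ^ N) -> A 0%nat = h c.
Proof.
intros Hr H. specialize (H (RtoC 0) 1%nat). rewrite Cmod_0 in H. specialize (H Hr).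
rewrite Csum_at_0, pow_1 in H. replace (c + 0)%C with c in H by ring.
symmetry. apply Ceq_minus, Cmod_eq_0. apply Rle_antisym; [|apply Cmod_ge_0].
eapply Rle_trans; [exact H|]. unfold Rdiv. rewrite Rmult_0_l. lra.
Qed.

Lemma cderiv_of_quadratic (h : C -> C) c l K rho : 0 < rho -> 0 <= K ->
  (forall q, Cmod q < rho -> Cmod (h (c + q) - h c - l * q)%C <= K * Cmod q ^ 2) ->
  cderiv h c l.
Proof.
intros Hr HK H. apply cderiv_eps. intros eps Heps.
exists (Rmin rho (eps / (K + 1))).
assert (Hq : 0 < eps / (K + 1)) by (apply Rdiv_lt_0_compat; lra).
split; [now apply Rmin_glb_lt|]. intros w Hw.
assert (H1 : Cmod (w - c) < rho) by (eapply Rlt_le_trans; [exact Hw|apply Rmin_l]).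
assert (H2 : Cmod (w - c) < eps / (K + 1)) by (eapply Rlt_le_trans; [exact Hw|apply Rmin_r]).
specialize (H (w - c)%C H1). replace (c + (w - c))%C with w in H by ring.
eapply Rle_trans; [exact H|].
apply (Rmult_lt_compat_r (K + 1)) in H2; [|lra].
replace (eps / (K + 1) * (K + 1)) with eps in H2 by (field; lra).
pose proof (Cmod_ge_0 (w - c)). simpl. rewrite Rmult_1_r, <- Rmult_assoc.
apply Rmult_le_compat_r; nra.
Qed.

Lemma taylor_coef_1 (h : C -> C) c (A : nat -> C) rho K : 0 < rho -> 0 <= K ->
  (forall (q : C) (N : nat), Cmod q < rho ->
      Cmod (h (c + q) - Csum (fun n => A n * q ^ n) N)%C
        <= K * (Cmod q / (2 * rho)) ^ N) -> cderiv h c (A 1%nat).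
Proof.
intros Hr HK H. assert (H0 := taylor_coef_0 h c A rho K Hr H).
assert (0 < / (2 * rho)) by (apply Rinv_0_lt_compat; lra).
apply cderiv_of_quadratic with (K := K * (/ (2 * rho)) ^ 2) (rho := rho); [exact Hr| |].
- apply Rmult_le_pos; [exact HK|]. apply pow_le; lra.
- intros q Hq. specialize (H q 2%nat Hq). unfold Rdiv in H. rewrite Rpow_mult_distr in H.
  cbn [Csum] in H. rewrite H0 in H.
  replace (h (c + q) - h c - A 1%nat * q)%C
    with (h (c + q) - (0 + h c * q ^ 0 + A 1%nat * q ^ 1))%C by (simpl; ring).
  lra.
Qed.

(** Expand [h] to second order at [c] and at [c + q], with remainders
    [O (|q|^3)].  Subtracting the values at [c + q + q] and [c + q - q] of the
    second expansion leaves [2 q h' (c + q)]; the first expansion, at [2 q],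
    gives [2 q h' c + 4 q^2 A 2] for the same difference.  Hence
    [h' (c + q) = h' c + 2 q A 2 + O (|q|^2)]. *)
Theorem cdiff_derive (h : C -> C) (c : C) : locally c (cdiff h) -> cdiff (C_derive h) c.
Proof.
intros H. destruct (taylor_locally h c H) as [rho [K [Hr [HK T]]]].
destruct (T c) as [_ [A HA]].
{ replace (c - c)%C with (RtoC 0) by ring. now rewrite Cmod_0. }
exists (2 * A 2%nat)%C.
set (L := K * (/ (2 * rho)) ^ 3).
assert (HL : 0 <= L).
{ apply Rmult_le_pos; [exact HK|]. apply pow_le, Rlt_le, Rinv_0_lt_compat. lra. }
assert (HL3 : forall q : C, K * (Cmod q / (2 * rho)) ^ 3 = L * Cmod q ^ 3).
{ intros q. unfold Rdiv, L. rewrite Rpow_mult_distr. ring. }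
apply (cderiv_of_quadratic _ c _ (5 * L) (rho / 2)); [lra|lra|].
intros q Hq.
destruct (T (c + q)%C) as [_ [B HB]].
{ replace (c + q - c)%C with q by ring. lra. }
rewrite (is_C_derive_unique h (c + q) (B 1%nat)) by exact (taylor_coef_1 h _ B rho K Hr HK HB).
rewrite (is_C_derive_unique h c (A 1%nat)) by exact (taylor_coef_1 h _ A rho K Hr HK HA).
assert (HA0 := taylor_coef_0 h c A rho K Hr HA).
assert (H1 := HB q 3%nat ltac:(lra)).
assert (H2 := HB (- q)%C 3%nat ltac:(rewrite Cmod_opp; lra)).
assert (Hq2 : Cmod (2 * q) = 2 * Cmod q).
{ rewrite Cmod_mult, Cmod_R, Rabs_pos_eq by lra. reflexivity. }
assert (H3 := HA (2 * q)%C 3%nat ltac:(rewrite Hq2; lra)).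
rewrite HL3 in H1, H2, H3. rewrite Hq2 in H3. rewrite Cmod_opp in H2.
cbn [Csum] in H1, H2, H3. rewrite HA0 in H3.
replace (c + q + q)%C with (c + 2 * q)%C in H1 by ring.
replace (c + q + - q)%C with c in H2 by ring.
destruct (Ceq_dec q 0) as [->|Hq0].
{ assert (EB : B 1%nat = A 1%nat).
  { assert (D1 := taylor_coef_1 h _ B rho K Hr HK HB).
    assert (D2 := taylor_coef_1 h _ A rho K Hr HK HA).
    apply is_C_derive_unique in D1. apply is_C_derive_unique in D2.
    replace (c + 0)%C with c in D1 by ring. congruence. }
  rewrite EB. replace (A 1%nat - A 1%nat - 2 * A 2%nat * 0)%C with (RtoC 0) by ring.
  rewrite Cmod_0. simpl. lra. }
assert (Hm := proj1 (Cmod_gt_0 q) Hq0).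
apply (Rmult_le_reg_l (2 * Cmod q)); [lra|].
rewrite <- Hq2, <- Cmod_mult, Hq2.
set (e1 := (h (c + 2 * q) - _)%C) in H1. set (e2 := (h c - _)%C) in H2.
set (e3 := (h (c + 2 * q) - _)%C) in H3.
replace (2 * q * (B 1%nat - A 1%nat - 2 * A 2%nat * q))%C with (e3 + e2 + - e1)%C.
2: { unfold e1, e2, e3. simpl. ring. }
eapply Rle_trans; [apply Cmod_triangle|]. rewrite Cmod_opp.
pose proof (Cmod_triangle e3 e2).
replace (2 * Cmod q * (5 * L * Cmod q ^ 2)) with (L * (2 * Cmod q) ^ 3 + L * Cmod q ^ 3 + L * Cmod q ^ 3) by ring.
lra.
Qed.

Lemma small_power_eq_0 (z : C) K x : 0 <= x < 1 -> (forall N, Cmod z <= K * x ^ N) -> z = 0%C.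
Proof.
intros Hx H. apply Cmod_eps_eq. intros eps Heps. replace (z - 0)%C with z by ring.
assert (HK : 0 <= K). { specialize (H 0%nat). simpl in H. pose proof (Cmod_ge_0 z). lra. }
destruct (pow_lt_1_zero x ltac:(rewrite Rabs_pos_eq; lra) (eps / (K + 1))
  ltac:(apply Rdiv_lt_0_compat; lra)) as [N HN].
specialize (HN N (Nat.le_refl N)). rewrite Rabs_pos_eq in HN by (apply pow_le; lra).
eapply Rle_trans; [apply (H N)|].
apply (Rmult_lt_compat_r (K + 1)) in HN; [|lra].
replace (eps / (K + 1) * (K + 1)) with eps in HN by (field; lra).
pose proof (pow_le x N ltac:(lra)). nra.
Qed.

Lemma Csum_0 (u : nat -> C) N : (forall n, (n < N)%nat -> u n = 0%C) -> Csum u N = 0%C.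
Proof.
induction N as [|N IH]; intros H; simpl; [reflexivity|]. rewrite IH, (H N) by auto. ring.
Qed.

Lemma Cpowz_of_nat z n : Cpowz z (Z.of_nat n) = (z ^ n)%C.
Proof. destruct n; [reflexivity|]. simpl. now rewrite SuccNat2Pos.id_succ. Qed.

Lemma locally_center (P : C -> Prop) z : locally z P -> P z.
Proof. apply (locally_singleton (T := C_UniformSpace)). Qed.

Lemma cdiff_Cpow z n : cdiff (fun w => w ^ n)%C z.
Proof.
induction n as [|n IH].
- exact (cdiff_const (RtoC 1) z).
- exact (cdiff_mult (fun w => w) (fun w => (w ^ n)%C) z (cdiff_id z) IH).
Qed.

(** If all Taylor coefficients at [z] vanish, the remainder estimate forces
    [h = 0] near [z].  Otherwise the least [m] with [A m <> 0] is the order: the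
    quotient of [h] by [(w - z)^m] extends by [A m], with derivative
    [A (S m)] at [z]. *)
Theorem zero_or_finite_order (h : C -> C) (z : C) : holomorphic_at h z ->
  locally z (fun w => h w = 0%C) \/ exists m : nat, is_order h z (Z.of_nat m) /\ (m = 0%nat -> h z <> 0%C).
Proof.
intros H. change (locally z (cdiff h)) in H.
destruct (taylor_locally h z H) as [rho [K [Hr [HK T]]]].
assert (Hall : forall w, Cmod (w - z) < rho -> cdiff h w) by (intros w Hw; now apply T).
destruct (T z) as [_ [A HA]].
{ replace (z - z)%C with (RtoC 0) by ring. now rewrite Cmod_0. }
clear T.
destruct (classic (exists n, A n <> 0%C)) as [Hex|Hnone].
- right.
  destruct (dec_inh_nat_subset_has_unique_least_element (fun n => A n <> 0%C)) as [m [[Hm Hmin] _]];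
    [|exact Hex|].
  { intros n. apply classic. }
  assert (Hlow : forall n, (n < m)%nat -> A n = 0%C).
  { intros n Hn. apply NNPP. intros E. specialize (Hmin n E). lia. }
  exists m. split.
  2: { intros ->. now rewrite <- (taylor_coef_0 h z A rho K Hr HA). }
  set (g := fun w => if Ceq_dec w z then A m else (h w / (w - z) ^ m)%C).
  assert (Hne : forall w, w <> z -> (w - z)%C <> 0%C) by (intros w Hw; now apply Cminus_eq_contra).
  assert (gz : g z = A m) by (unfold g; destruct (Ceq_dec z z); tauto).
  assert (gw : forall w, w <> z -> g w = (h w / (w - z) ^ m)%C).
  { intros w Hw. unfold g. destruct (Ceq_dec w z); tauto. }
  exists g. split; [|split].
  + change (locally z (cdiff g)). apply locally_Cmod. exists rho. split; [exact Hr|].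
    intros w Hw. destruct (Ceq_dec w z) as [->|Hwz].
    * exists (A (S m)). apply (cderiv_of_quadratic _ _ _ (K * (/ (2 * rho)) ^ (m + 2)) rho); [exact Hr| |].
      { apply Rmult_le_pos; [exact HK|]. apply pow_le, Rlt_le, Rinv_0_lt_compat. lra. }
      intros q Hq. rewrite gz. destruct (Ceq_dec q 0) as [->|Hq0].
      { replace (z + 0)%C with z by ring. rewrite gz.
        replace (A m - A m - A (S m) * 0)%C with (RtoC 0) by ring. rewrite Cmod_0. simpl. lra. }
      assert (Hzq : (z + q)%C <> z).
      { intros E. apply Hq0. replace q with (z + q - z)%C by ring. rewrite E. ring. }
      rewrite gw by exact Hzq. replace (z + q - z)%C with q by ring.
      assert (Hqm : (q ^ m)%C <> 0%C) by now apply Cpow_nz.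
      specialize (HA q (S (S m)) Hq). cbn [Csum] in HA.
      rewrite (Csum_0 (fun n => A n * q ^ n)%C m) in HA by (intros n Hn; rewrite (Hlow n Hn); ring).
      replace (h (z + q)%C / q ^ m - A m - A (S m) * q)%C
        with ((h (z + q)%C - (0 + A m * q ^ m + A (S m) * q ^ S m)) / q ^ m)%C
        by (rewrite Cpow_S; field; exact Hqm).
      rewrite Cmod_div, Cmod_pow by exact Hqm.
      assert (Hm' := proj1 (Cmod_gt_0 q) Hq0).
      assert (0 < Cmod q ^ m) by now apply pow_lt.
      apply (Rmult_le_reg_r (Cmod q ^ m)); [assumption|].
      unfold Rdiv at 1. rewrite Rmult_assoc, Rinv_l, Rmult_1_r by lra.
      eapply Rle_trans; [exact HA|]. right.
      unfold Rdiv. rewrite Rpow_mult_distr. replace (S (S m)) with (m + 2)%nat by lia.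
      rewrite (pow_add (Cmod q)). ring.
    * apply cdiff_ext_loc with (fun w => h w * / (w - z) ^ m)%C.
      { apply locally_Cmod. exists (Cmod (w - z)). split; [now apply Cmod_gt_0, Hne|].
        intros u Hu. rewrite gw; [reflexivity|]. intros ->.
        rewrite <- Cmod_opp in Hu. replace (- (z - w))%C with (w - z)%C in Hu by ring. lra. }
      apply cdiff_mult; [now apply Hall|]. apply cdiff_inv.
      { apply (cdiff_comp (fun v => v ^ m)%C (fun v => v - z)%C); [apply cdiff_Cpow|].
        apply cdiff_minus; [apply cdiff_id|apply cdiff_const]. }
      now apply Cpow_nz, Hne.
  + now rewrite gz.
  + exists (mkposreal 1 Rlt_0_1). intros w _ Hw. rewrite Cpowz_of_nat, gw by exact Hw.
    field. now apply Cpow_nz, Hne.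
- left. apply locally_Cmod. exists rho. split; [exact Hr|]. intros w Hw.
  apply (small_power_eq_0 _ K (Cmod (w - z) / (2 * rho))).
  + split; [apply Rdiv_le_0_compat; [apply Cmod_ge_0|lra]|].
    apply (Rmult_lt_reg_r (2 * rho)); [lra|]. unfold Rdiv. rewrite Rmult_assoc, Rinv_l by lra. lra.
  + intros N. specialize (HA (w - z)%C N Hw). replace (z + (w - z))%C with w in HA by ring.
    rewrite Csum_0 in HA.
    * now replace (h w - 0)%C with (h w) in HA by ring.
    * intros n _. replace (A n) with (RtoC 0); [ring|]. apply NNPP. intros E. apply Hnone.
      exists n. congruence.
Qed.

(** If [h] vanishes near [c], each Taylor coefficient is zero: given that the
    earlier ones are, the estimate with [S n] terms reads
    [|A n| s^n <= K s^(n+1)] for small [s]. *)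
Lemma vanish_disc (h : C -> C) c R0 : (forall w, Cmod (w - c) < R0 -> cdiff h w) ->
  locally c (fun w => h w = 0%C) -> forall w, Cmod (w - c) < R0 -> h w = 0%C.
Proof.
intros Hd H0 w Hw. set (q := (w - c)%C) in *.
set (r := (Cmod q + R0) / 2).
pose proof (Cmod_ge_0 q).
assert (Hr : 0 < r < R0) by (unfold r; lra).
assert (Hqr : Cmod q < r) by (unfold r; lra).
destruct (curve_bounded (fun x => h (circle c r x)) 0 1 ltac:(lra)) as [M HM].
{ intros t _.
  assert (Dk : cdiff (fun z => h (c + RtoC r * expi 1 z)%C) (t, 0)).
  { apply (cdiff_comp h (fun z => c + RtoC r * expi 1 z)%C).
    - apply Hd. assert (E := circle_dist c r t ltac:(lra)). unfold circle in E.
      change (RtoC t) with ((t, 0) : C) in E. lra.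
    - apply cdiff_plus; [apply cdiff_const|]. apply cdiff_mult; [apply cdiff_const|apply cdiff_expi]. }
  assert (Ck := C_continuous_horizontal _ t 0 (cdiff_continuous _ _ Dk)). exact Ck. }
destruct (taylor_estimate h c R0 r M Hr Hd HM) as [A HA].
apply locally_Cmod in H0. destruct H0 as [d [Hd0 H0]].
assert (HM0 : 0 <= M) by (eapply Rle_trans; [apply Cmod_ge_0|apply (HM 0); lra]).
assert (HA0 : forall n, A n = 0%C).
{ intros n. induction n as [n IH] using (well_founded_induction lt_wf).
  apply Cmod_eps_eq. intros eps Heps. replace (A n - 0)%C with (A n) by ring.
  set (b := Rmin d r / 2).
  assert (Hb : 0 < b) by (unfold b; pose proof (Rmin_glb_lt d r 0 Hd0 (proj1 Hr)); lra).
  set (K := 2 * M * (/ r) ^ S n).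
  assert (HK : 0 <= K).
  { unfold K. apply Rmult_le_pos; [lra|]. apply pow_le, Rlt_le, Rinv_0_lt_compat; lra. }
  set (s := Rmin (Rmin b (r / 2)) (eps / (K + 1))).
  pose proof (Rmin_l (Rmin b (r / 2)) (eps / (K + 1))). pose proof (Rmin_r (Rmin b (r / 2)) (eps / (K + 1))).
  pose proof (Rmin_l b (r / 2)). pose proof (Rmin_r b (r / 2)).
  pose proof (Rmin_l d r). pose proof (Rmin_r d r).
  assert (He : 0 < eps / (K + 1)) by (apply Rdiv_lt_0_compat; lra).
  assert (Hs : 0 < s) by (repeat apply Rmin_glb_lt; lra).
  fold s in H1, H2.
  assert (Hms : Cmod (RtoC s) = s) by (rewrite Cmod_R; apply Rabs_pos_eq; lra).
  assert (T := HA (RtoC s) (S n)). rewrite Hms in T.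
  specialize (T ltac:(lra)). cbn [Csum] in T.
  rewrite (Csum_0 (fun n => A n * RtoC s ^ n)%C n) in T by (intros m Hm; rewrite (IH m Hm); ring).
  rewrite (H0 (c + RtoC s)%C) in T.
  2: { replace (c + RtoC s - c)%C with (RtoC s) by ring. rewrite Hms. unfold b in *. lra. }
  replace (0 - (0 + A n * RtoC s ^ n))%C with (- (A n * RtoC s ^ n))%C in T by ring.
  rewrite Cmod_opp, Cmod_mult, Cmod_pow, Hms, Cmod_0, Rplus_0_r in T.
  assert (Hsn : 0 < s ^ n) by now apply pow_lt.
  apply (Rmult_le_reg_r (s ^ n)); [exact Hsn|].
  eapply Rle_trans; [exact T|].
  assert (Hsr : 0 < s / r <= 1 / 2).
  { split; [apply Rdiv_lt_0_compat; lra|].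
    apply (Rmult_le_reg_r r); [lra|]. unfold Rdiv at 1. rewrite Rmult_assoc, Rinv_l by lra. lra. }
  apply Rle_trans with (M / (1 / 2) * (s / r) ^ S n).
  { apply Rmult_le_compat_r; [apply pow_le; lra|]. apply Rmult_le_compat_l; [exact HM0|].
    apply Rinv_le_contravar; lra. }
  unfold Rdiv at 3. rewrite Rpow_mult_distr.
  replace (M / (1 / 2) * (s ^ S n * (/ r) ^ S n)) with (K * s * s ^ n) by (unfold K; simpl; field; lra).
  apply Rmult_le_compat_r; [lra|].
  assert (s * (K + 1) <= eps).
  { replace eps with (eps / (K + 1) * (K + 1)) by (field; lra). apply Rmult_le_compat_r; lra. }
  nra. }
apply (small_power_eq_0 _ ((M + Cmod (h w)) / (1 - Cmod q / r)) (Cmod q / r)).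
- split; [apply Rdiv_le_0_compat; lra|].
  apply (Rmult_lt_reg_r r); [lra|]. unfold Rdiv. rewrite Rmult_assoc, Rinv_l by lra. lra.
- intros N. specialize (HA q N Hqr). unfold q in HA at 1 3. replace (c + (w - c))%C with w in HA by ring.
  rewrite Csum_0 in HA by (intros n _; rewrite HA0; ring).
  now replace (h w - 0)%C with (h w) in HA by ring.
Qed.

(** From [p] to [w] along a segment in finitely many steps shorter than [rho]:
    every point of the segment is the centre of a disc of radius [rho] inside
    the half-plane. *)
Theorem identity_half_plane (h : C -> C) (Y : R) (p : C) :
  (forall w, Y < Im w -> cdiff h w) -> Y < Im p ->
  locally p (fun w => h w = 0%C) -> forall w, Y < Im w -> h w = 0%C.
Proof.
intros Hd Hp H0 w Hw.
set (rho := Rmin (Im p) (Im w) - Y).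
assert (Hrho : 0 < rho) by (unfold rho; pose proof (Rmin_glb_lt _ _ _ Hp Hw); lra).
assert (Hdisc : forall c, Rmin (Im p) (Im w) <= Im c -> forall u, Cmod (u - c) < rho -> cdiff h u).
{ intros c Hc u Hu. apply Hd.
  pose proof (Rmax_Cmod (u - c)%C) as Hm. pose proof (Rmax_r (Rabs (fst (u - c)%C)) (Rabs (snd (u - c)%C))).
  assert (Hs : Rabs (snd (u - c)%C) < rho) by lra.
  apply Rabs_def2 in Hs. unfold rho, Im in *. simpl in Hs. lra. }
destruct (archimed_cor1 (rho / (Cmod (w - p) + 1))) as [n [Hn Hn0]].
{ apply Rdiv_lt_0_compat; [exact Hrho|]. pose proof (Cmod_ge_0 (w - p)). lra. }
assert (Hn1 : 0 < INR n) by now apply lt_0_INR.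
set (pt := fun k : nat => (p + RtoC (INR k / INR n) * (w - p))%C).
assert (Hstep : Cmod (w - p) / INR n < rho).
{ pose proof (Cmod_ge_0 (w - p)).
  apply (Rmult_lt_compat_r (Cmod (w - p) + 1)) in Hn; [|lra].
  replace (rho / (Cmod (w - p) + 1) * (Cmod (w - p) + 1)) with rho in Hn by (field; lra).
  assert (0 < / INR n) by now apply Rinv_0_lt_compat.
  unfold Rdiv. nra. }
assert (Him : forall k, (k <= n)%nat -> Rmin (Im p) (Im w) <= Im (pt k)).
{ intros k Hk. apply le_INR in Hk.
  assert (Hx : 0 <= INR k / INR n <= 1).
  { split; [apply Rdiv_le_0_compat; [apply pos_INR|lra]|].
    apply (Rmult_le_reg_r (INR n)); [lra|]. unfold Rdiv. rewrite Rmult_assoc, Rinv_l by lra. lra. }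
  replace (Im (pt k)) with (Im p + INR k / INR n * (Im w - Im p)).
  2: { unfold pt, Im, RtoC; simpl. ring. }
  set (x := INR k / INR n) in *.
  unfold Rmin. destruct (Rle_dec (Im p) (Im w)); nra. }
assert (Hk : forall k, (k <= n)%nat -> locally (pt k) (fun u => h u = 0%C)).
{ induction k as [|k IH]; intros Hk.
  - replace (pt 0%nat) with p; [exact H0|]. unfold pt. simpl. unfold Rdiv. rewrite Rmult_0_l. ring.
  - specialize (IH ltac:(lia)).
    assert (V := vanish_disc h (pt k) rho (Hdisc (pt k) (Him k ltac:(lia))) IH).
    apply locally_Cmod. exists (rho - Cmod (w - p) / INR n). split; [lra|].
    intros u Hu. apply V.
    replace (u - pt k)%C with ((u - pt (S k)) + (pt (S k) - pt k))%C by ring.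
    eapply Rle_lt_trans; [apply Cmod_triangle|].
    replace (pt (S k) - pt k)%C with (RtoC (/ INR n) * (w - p))%C.
    + rewrite Cmod_mult, Cmod_R, Rabs_pos_eq by (apply Rlt_le, Rinv_0_lt_compat; lra).
      unfold Rdiv in Hu. lra.
    + unfold pt. rewrite S_INR.
      replace ((INR k + 1) / INR n) with (INR k / INR n + / INR n) by (field; lra).
      rewrite RtoC_plus. ring. }
specialize (Hk n (Nat.le_refl n)). apply locally_center in Hk.
replace w with (pt n); [exact Hk|]. unfold pt. unfold Rdiv. rewrite Rinv_r by lra. ring.
Qed.

(** * Expansions in powers of q *)

Lemma sum_n_Csum (u : nat -> C) n : sum_n (G := C_AbelianMonoid) u n = Csum u (S n).
Proof.
induction n as [|n IH].
- rewrite sum_O. simpl. ring.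
- rewrite sum_Sn, IH. reflexivity.
Qed.

Lemma is_series_Csum (u : nat -> C) (l : C) :
  is_series (K := C_AbsRing) (V := C_NormedModule) u l ->
  forall eps, 0 < eps -> exists n0, forall n, (n0 <= n)%nat -> Cmod (Csum u n - l) < eps.
Proof.
intros H eps Heps.
destruct (H (fun w => Cmod (w - l) < eps)) as [n0 Hn0].
- apply locally_Cmod. exists eps. tauto.
- exists (S n0). intros n Hn. destruct n as [|n]; [lia|].
  specialize (Hn0 n ltac:(lia)).
  change (sum_n u n) with (sum_n (G := C_AbelianMonoid) u n) in Hn0.
  now rewrite sum_n_Csum in Hn0.
Qed.

Lemma Csum_geometric_bound (u : nat -> C) B x J J' : 0 <= x < 1 -> 0 <= B ->
  (forall n, Cmod (u n) <= B * x ^ n) -> (J <= J')%nat ->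
  Cmod (Csum u J' - Csum u J) <= B / (1 - x) * (x ^ J - x ^ J').
Proof.
intros Hx HB Hu HJ. induction HJ as [|J' HJ IH].
- replace (Csum u J - Csum u J)%C with (RtoC 0) by ring. rewrite Cmod_0. lra.
- cbn [Csum]. replace (Csum u J' + u J' - Csum u J)%C with ((Csum u J' - Csum u J) + u J')%C by ring.
  eapply Rle_trans; [apply Cmod_triangle|].
  specialize (Hu J').
  replace (B / (1 - x) * (x ^ J - x ^ S J')) with (B / (1 - x) * (x ^ J - x ^ J') + B * x ^ J')
    by (simpl; field; lra). lra.
Qed.

Lemma Csum_tail_bound (u : nat -> C) (l : C) B x J : 0 <= x < 1 -> 0 <= B ->
  (forall n, Cmod (u n) <= B * x ^ n) ->
  (forall eps, 0 < eps -> exists n0, forall n, (n0 <= n)%nat -> Cmod (Csum u n - l) < eps) ->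
  Cmod (l - Csum u J) <= B / (1 - x) * x ^ J.
Proof.
intros Hx HB Hu Hl. apply le_epsilon. intros eps Heps.
destruct (Hl eps Heps) as [n0 Hn0]. specialize (Hn0 (n0 + J)%nat ltac:(lia)).
pose proof (Csum_geometric_bound u B x J (n0 + J) Hx HB Hu ltac:(lia)).
replace (l - Csum u J)%C with (- (Csum u (n0 + J) - l) + (Csum u (n0 + J) - Csum u J))%C by ring.
eapply Rle_trans; [apply Cmod_triangle|]. rewrite Cmod_opp.
assert (0 <= B / (1 - x)) by (apply Rdiv_le_0_compat; lra).
pose proof (pow_le x (n0 + J) ltac:(lra)). nra.
Qed.

Lemma is_series_terms_bounded (u : nat -> C) (l : C) :
  is_series (K := C_AbsRing) (V := C_NormedModule) u l -> exists B, 0 <= B /\ forall n, Cmod (u n) <= B.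
Proof.
intros H. destruct (is_series_Csum u l H 1 Rlt_0_1) as [n0 Hn0].
assert (Hfin : exists B, forall n, (n < n0)%nat -> Cmod (u n) <= B).
{ clear. induction n0 as [|n0 [B HB]].
  - exists 0. intros; lia.
  - exists (Rmax B (Cmod (u n0))). intros n Hn. destruct (Nat.eq_dec n n0) as [->|Hne].
    + apply Rmax_r.
    + eapply Rle_trans; [apply HB; lia|apply Rmax_l]. }
destruct Hfin as [B HB]. exists (Rmax B 2). split.
{ eapply Rle_trans; [|apply Rmax_r]. lra. }
intros n. destruct (Nat.lt_ge_cases n n0) as [Hn|Hn].
- eapply Rle_trans; [now apply HB|apply Rmax_l].
- eapply Rle_trans; [|apply Rmax_r].
  pose proof (Hn0 n Hn). pose proof (Hn0 (S n) ltac:(lia)) as H1. cbn [Csum] in H1.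
  replace (u n) with ((Csum u n + u n - l) + - (Csum u n - l))%C by ring.
  eapply Rle_trans; [apply Cmod_triangle|]. rewrite Cmod_opp. lra.
Qed.

Lemma exp_nat_mult x n : exp (INR n * x) = exp x ^ n.
Proof.
induction n as [|n IH]; [simpl; rewrite Rmult_0_l; apply exp_0|].
rewrite S_INR, Rmult_plus_distr_r, exp_plus, IH, Rmult_1_l. simpl. ring.
Qed.

Lemma Cmod_expi_nat n t : Cmod (expi (Z.of_nat n) t) = exp (- (2 * PI * Im t)) ^ n.
Proof.
rewrite Cmod_expi, <- exp_nat_mult, <- INR_IZR_INZ. f_equal. ring.
Qed.

(** Multiplying by [expi M], which is [q^M], removes the negative powers. *)
Section Expansion.
Variables (F : C -> C) (a : Z -> C) (M : nat) (Y : R).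
Hypothesis Fser : forall tau : C, Y < Im tau ->
  is_series (K := C_AbsRing) (V := C_NormedModule)
    (fun j : nat => let n := (Z.of_nat j - Z.of_nat M)%Z in (a n * qpow 1 n tau)%C) (F tau).

Let Ft := fun z => (F z * expi (Z.of_nat M) z)%C.
Let b := fun j : nat => a (Z.of_nat j - Z.of_nat M)%Z.

(** Convergence at a height [y'] below [y] bounds the terms, which at height [y]
    and above then decrease like the powers of
    [rho = exp (- 2 pi (y - y'))]. *)
Lemma expansion_uniform y : Y < y -> exists B rho, 0 <= B /\ 0 < rho < 1 /\
  forall z J, y <= Im z ->
  Cmod (Ft z - Csum (fun j => b j * expi (Z.of_nat j) z)%C J) <= B * rho ^ J.
Proof.
intros Hy. set (y' := (Y + y) / 2).
pose proof PI_RGT_0 as Hpi.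
destruct (is_series_terms_bounded _ _ (Fser (0, y') ltac:(simpl; unfold y'; lra))) as [B0 [HB0 HB]].
set (rho := exp (- (2 * PI * (y - y')))).
assert (Hrho : 0 < rho < 1).
{ split; [apply exp_pos|]. rewrite <- exp_0. apply exp_increasing.
  assert (0 < 2 * PI * (y - y')); [|lra]. apply Rmult_lt_0_compat; unfold y'; lra. }
set (B := B0 * Cmod (expi (Z.of_nat M) (0, y'))).
assert (HBp : 0 <= B) by (apply Rmult_le_pos; [exact HB0|apply Cmod_ge_0]).
exists (B / (1 - rho)), rho. split; [apply Rdiv_le_0_compat; lra|]. split; [exact Hrho|].
assert (Hb : forall j, Cmod (b j * expi (Z.of_nat j) (0, y')) <= B).
{ intros j. specialize (HB j). cbv zeta in HB. rewrite qpow_expi in HB.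
  replace (b j * expi (Z.of_nat j) (0, y'))%C
    with (a (Z.of_nat j - Z.of_nat M)%Z * expi (Z.of_nat j - Z.of_nat M) (0, y') * expi (Z.of_nat M) (0, y'))%C.
  - rewrite Cmod_mult. unfold B. apply Rmult_le_compat_r; [apply Cmod_ge_0|exact HB].
  - rewrite <- Cmult_assoc, <- expi_plus. unfold b. do 2 f_equal. lia. }
intros z J Hz.
apply (Csum_tail_bound _ _ B rho J); [lra|exact HBp| |].
- intros n. rewrite Cmod_mult, Cmod_expi_nat.
  specialize (Hb n). rewrite Cmod_mult, Cmod_expi_nat in Hb. change (Im (0, y')) with y' in Hb.
  apply Rle_trans with (Cmod (b n) * (exp (- (2 * PI * y')) ^ n * rho ^ n)).
  + apply Rmult_le_compat_l; [apply Cmod_ge_0|]. rewrite <- Rpow_mult_distr.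
    apply pow_incr. split; [apply Rlt_le, exp_pos|].
    unfold rho. rewrite <- exp_plus.
    assert (HH : - (2 * PI * Im z) <= - (2 * PI * y') + - (2 * PI * (y - y'))) by nra.
    destruct HH as [HH|HH]; [now apply Rlt_le, exp_increasing|rewrite HH; lra].
  + rewrite <- Rmult_assoc. apply Rmult_le_compat_r; [apply pow_le; lra|exact Hb].
- intros eps Heps.
  assert (Hp : 0 < Cmod (expi (Z.of_nat M) z)) by (apply Cmod_gt_0, expi_nz).
  destruct (is_series_Csum _ _ (Fser z ltac:(lra)) (eps / Cmod (expi (Z.of_nat M) z))
    ltac:(now apply Rdiv_lt_0_compat)) as [n0 Hn0].
  exists n0. intros n Hn. specialize (Hn0 n Hn).
  rewrite (Csum_ext _ (fun j => expi (Z.of_nat M) z *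
    (let n := (Z.of_nat j - Z.of_nat M)%Z in a n * qpow 1 n z))%C).
  + rewrite Csum_mult. unfold Ft.
    match goal with |- Cmod (?e * ?s - ?f * ?e) < _ => replace (e * s - f * e)%C with (e * (s - f))%C by ring end.
    rewrite Cmod_mult. apply (Rmult_lt_compat_l _ _ _ Hp) in Hn0.
    replace (Cmod (expi (Z.of_nat M) z) * (eps / Cmod (expi (Z.of_nat M) z))) with eps in Hn0
      by (field; lra). exact Hn0.
  + intros j _. cbv zeta. rewrite qpow_expi.
    replace (expi (Z.of_nat j) z) with (expi (Z.of_nat j - Z.of_nat M) z * expi (Z.of_nat M) z)%C.
    * unfold b. ring.
    * rewrite <- expi_plus. f_equal. lia.
Qed.

(** By uniform convergence the series may be integrated termwise against
    [expi (- n)], and only the [n]-th term has a nonzero mean. *)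
Lemma expansion_coef y n : Y < y -> (forall z, Im z = y -> cdiff F z) ->
  fourier_coef Ft (Z.of_nat n) y = b n.
Proof.
intros Hy Hd.
destruct (expansion_uniform y Hy) as [B [rho [HB [Hrho H]]]].
assert (HFt : forall z, Im z = y -> cdiff Ft z).
{ intros z Hz. apply cdiff_mult; [now apply Hd|apply cdiff_expi]. }
assert (E : (fourier_coef Ft (Z.of_nat n) y - b n)%C = 0%C).
{ set (D := Cmod (expi (- Z.of_nat n) (0, y))).
  apply (small_power_eq_0 _ (B * D * rho ^ S n) rho); [lra|]. intros J.
  set (u := fun j z => (b j * (expi (Z.of_nat j) z * expi (- Z.of_nat n) z))%C).
  assert (Hue : forall j, ex_period_mean (fun z => expi (Z.of_nat j) z * expi (- Z.of_nat n) z)%C y).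
  { intros j. apply ex_fourier_coef. intros; apply cdiff_expi. }
  assert (Hu : forall j, ex_period_mean (u j) y) by (intros j; apply ex_period_mean_Cmult, Hue).
  destruct (period_mean_Csum u y (S n + J) Hu) as [S1 S2].
  assert (Hval : forall j, period_mean (u j) y = if Nat.eq_dec j n then b n else 0%C).
  { intros j. unfold u. rewrite period_mean_Cmult by apply Hue.
    rewrite (period_mean_ext _ (expi (Z.of_nat j - Z.of_nat n))) by (intros x; now rewrite <- expi_plus).
    destruct (Nat.eq_dec j n) as [->|Hne].
    - rewrite Z.sub_diag, (period_mean_ext _ (fun _ => 1%C)), period_mean_const by (intros; apply expi_0). ring.
    - rewrite period_mean_expi by lia. ring. }
  assert (Hsum : forall K, (n < K)%nat -> Csum (fun j => period_mean (u j) y) K = b n).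
  { intros K HK. induction HK as [|K HK IH]; cbn [Csum].
    - rewrite (Csum_0 (fun j => period_mean (u j) y) n).
      + rewrite Hval. destruct (Nat.eq_dec n n); [ring|congruence].
      + intros j Hj. rewrite Hval. destruct (Nat.eq_dec j n); [lia|reflexivity].
    - rewrite IH, Hval. destruct (Nat.eq_dec K n); [lia|]. ring. }
  rewrite Hsum in S2 by lia. rewrite <- S2. unfold fourier_coef.
  assert (EF : ex_period_mean (fun z => Ft z * expi (- Z.of_nat n) z)%C y) by (apply ex_fourier_coef, HFt).
  rewrite <- (period_mean_minus (fun z => Ft z * expi (- Z.of_nat n) z)%C (fun z => Csum (fun j => u j z) (S n + J)) y EF S1).
  apply Cmod_period_mean_le; [exact (ex_period_mean_minus _ _ y EF S1)|].
  intros x.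
  replace (Ft (x, y) * expi (- Z.of_nat n) (x, y) - Csum (fun j => u j (x, y)) (S n + J))%C
   with (expi (- Z.of_nat n) (x, y) * (Ft (x, y) - Csum (fun j => b j * expi (Z.of_nat j) (x, y)) (S n + J)))%C.
  2: { rewrite (Csum_ext (fun j => u j (x, y)) (fun j => expi (- Z.of_nat n) (x, y) * (b j * expi (Z.of_nat j) (x, y)))%C)
        by (intros j _; unfold u; ring). rewrite Csum_mult. ring. }
  rewrite Cmod_mult.
  replace (Cmod (expi (- Z.of_nat n) (x, y))) with D by (unfold D; rewrite !Cmod_expi; reflexivity).
  replace (B * D * rho ^ S n * rho ^ J) with (D * (B * rho ^ (S n + J))) by (rewrite pow_add; ring).
  apply Rmult_le_compat_l; [apply Cmod_ge_0|]. apply H. simpl; lra. }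
now apply Ceq_minus.
Qed.

End Expansion.

(** * The logarithmic derivative at a point of the divisor *)

Lemma cderiv_Cpow z0 z n : z <> z0 ->
  cderiv (fun w => (w - z0) ^ n)%C z (RtoC (INR n) / (z - z0) * (z - z0) ^ n)%C.
Proof.
intros Hz. assert (Hz' := Cminus_eq_contra _ _ Hz).
induction n as [|n IH].
- eapply cderiv_eq; [exact (cderiv_const (RtoC 1) z)|]. simpl. field. exact Hz'.
- eapply cderiv_eq.
  + apply (cderiv_mult (fun w => w - z0)%C (fun w => (w - z0) ^ n)%C z (1 - 0)%C); [|exact IH].
    apply cderiv_minus; [apply cderiv_id|apply cderiv_const].
  + cbv beta. rewrite S_INR, RtoC_plus, Cpow_S. field. exact Hz'.
Qed.

Lemma cderiv_Cpowz z0 z m : z <> z0 ->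
  cderiv (fun w => Cpowz (w - z0) m) z (ZtoC m / (z - z0) * Cpowz (z - z0) m)%C.
Proof.
intros Hz. assert (Hz' := Cminus_eq_contra _ _ Hz).
destruct m as [|p|p]; unfold Cpowz, ZtoC.
- eapply cderiv_eq; [exact (cderiv_const (RtoC 1) z)|]. field. exact Hz'.
- eapply cderiv_eq; [now apply cderiv_Cpow|].
  now rewrite INR_IZR_INZ, positive_nat_Z.
- eapply cderiv_eq.
  + apply (cderiv_inv (fun w => (w - z0) ^ Pos.to_nat p)%C); [now apply cderiv_Cpow|now apply Cpow_nz].
  + cbv beta. rewrite INR_IZR_INZ, positive_nat_Z.
    change (Z.neg p) with (- Z.pos p)%Z. rewrite opp_IZR, RtoC_opp. field.
    split; [now apply Cpow_nz|exact Hz'].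
Qed.

Lemma Cpowz_nz (z : C) m : z <> 0%C -> Cpowz z m <> 0%C.
Proof.
intros Hz. destruct m; unfold Cpowz.
- exact C1_nz.
- exact (Cpow_nz z _ Hz).
- intros E. assert (H := Cpow_nz z (Pos.to_nat p) Hz).
  apply C1_nz. rewrite <- (Cinv_r _ H), E. ring.
Qed.

(** With [f = (z - z0)^m g], the logarithmic derivative of [f] is
    [m / (z - z0) + g' / g], and the second term is bounded near [z0] since
    [g'] is continuous and [g z0 <> 0]. *)
Lemma log_derivative_order f z0 m : is_order f z0 m ->
  exists d K : R, 0 < d /\ forall z, z <> z0 -> Cmod (z - z0) < d ->
    f z <> 0%C /\ Cmod (C_derive f z / f z - ZtoC m / (z - z0)) <= K.
Proof.
intros [g [Hg [Hg0 He]]].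
change (locally z0 (cdiff g)) in Hg.
destruct He as [d1 He].
assert (Hgc := cdiff_continuous g z0 (locally_center _ _ Hg)).
assert (Hg'c := cdiff_continuous _ z0 (cdiff_derive g z0 Hg)).
assert (Hm := proj1 (Cmod_gt_0 _) Hg0).
destruct (Hgc (Cmod (g z0) / 2) ltac:(lra)) as [d2 [Hd2 H2]].
destruct (Hg'c 1 Rlt_0_1) as [d3 [Hd3 H3]].
apply locally_Cmod in Hg. destruct Hg as [d4 [Hd4 H4]].
assert (He' : locally z0 (fun w => w <> z0 -> f w = (Cpowz (w - z0) m * g w)%C)).
{ exists d1. exact He. }
apply locally_Cmod in He'. destruct He' as [d5 [Hd5 H5]].
set (d := Rmin (Rmin d2 d3) (Rmin d4 d5)).
pose proof (Rmin_l (Rmin d2 d3) (Rmin d4 d5)). pose proof (Rmin_r (Rmin d2 d3) (Rmin d4 d5)).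
pose proof (Rmin_l d2 d3). pose proof (Rmin_r d2 d3). pose proof (Rmin_l d4 d5). pose proof (Rmin_r d4 d5).
fold d in H, H0.
exists d, ((Cmod (C_derive g z0) + 1) / (Cmod (g z0) / 2)).
split; [repeat apply Rmin_glb_lt; assumption|].
intros z Hz Hzd.
specialize (H2 z ltac:(lra)). specialize (H3 z ltac:(lra)). specialize (H4 z ltac:(lra)).
assert (Hzz := Cminus_eq_contra _ _ Hz).
assert (Hgz : Cmod (g z0) / 2 <= Cmod (g z)).
{ pose proof (Cmod_triangle_rev (g z0) (g z0 - g z)) as T.
  replace (g z0 - (g z0 - g z))%C with (g z) in T by ring.
  rewrite <- Cmod_opp in H2. replace (- (g z - g z0))%C with (g z0 - g z)%C in H2 by ring. lra. }
assert (Hgz0 : g z <> 0%C) by (apply Cmod_gt_0; lra).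
assert (Hpz := Cpowz_nz (z - z0)%C m Hzz).
assert (Ef : f z = (Cpowz (z - z0) m * g z)%C) by (apply H5; [lra|exact Hz]).
split; [rewrite Ef; now apply Cmult_neq_0|].
assert (Df : cderiv f z (ZtoC m / (z - z0) * Cpowz (z - z0) m * g z + Cpowz (z - z0) m * C_derive g z)%C).
{ apply cderiv_ext_loc with (fun w => Cpowz (w - z0) m * g w)%C.
  - apply locally_Cmod. exists (Rmin (Cmod (z - z0)) (d - Cmod (z - z0))).
    split; [apply Rmin_glb_lt; [now apply Cmod_gt_0|lra]|].
    intros w Hw. symmetry.
    pose proof (Rmin_l (Cmod (z - z0)) (d - Cmod (z - z0))). pose proof (Rmin_r (Cmod (z - z0)) (d - Cmod (z - z0))).
    apply H5.
    + replace (w - z0)%C with ((w - z) + (z - z0))%C by ring.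
      eapply Rle_lt_trans; [apply Cmod_triangle|]. lra.
    + intros ->. rewrite <- Cmod_opp in Hw. replace (- (z0 - z))%C with (z - z0)%C in Hw by ring. lra.
  - apply cderiv_mult; [now apply cderiv_Cpowz|]. apply C_derive_correct; [exact z|exact H4]. }
rewrite (is_C_derive_unique f z _ Df), Ef.
replace ((ZtoC m / (z - z0) * Cpowz (z - z0) m * g z + Cpowz (z - z0) m * C_derive g z) / (Cpowz (z - z0) m * g z)
  - ZtoC m / (z - z0))%C with (C_derive g z / g z)%C by (field; repeat split; assumption).
rewrite Cmod_div by exact Hgz0.
apply Rmult_le_compat.
- apply Cmod_ge_0.
- apply Rlt_le, Rinv_0_lt_compat. lra.
- replace (C_derive g z) with (C_derive g z0 + (C_derive g z - C_derive g z0))%C by ring.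
  eapply Rle_trans; [apply Cmod_triangle|]. lra.
- apply Rinv_le_contravar; lra.
Qed.

(** * The growth rate of a sequence *)

Definition growth_rate (a : nat -> C) (n : nat) : Rbar :=
  Rbar_div (Rbar_ln (Cmod (a n))) (Finite (2 * PI * INR n)).

Lemma growth_rate_le (a : nat -> C) n y : (0 < n)%nat ->
  Rbar_le (growth_rate a n) (Finite y) <-> Cmod (a n) <= exp (INR n * (2 * PI * y)).
Proof.
intros Hn. assert (HN : 0 < INR n) by now apply lt_0_INR.
pose proof PI_RGT_0 as Hpi.
assert (HD : 0 < 2 * PI * INR n) by (apply Rmult_lt_0_compat; lra).
unfold growth_rate, Rbar_ln. destruct (Rlt_dec 0 (Cmod (a n))) as [H|H].
- change (Rbar_le (Rbar_div (ln (Cmod (a n))) (2 * PI * INR n)) y)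
   with (ln (Cmod (a n)) / (2 * PI * INR n) <= y).
  rewrite <- (exp_ln _ H) at 2.
  replace (INR n * (2 * PI * y)) with (y * (2 * PI * INR n)) by ring.
  set (L := ln (Cmod (a n))). set (D := 2 * PI * INR n) in *.
  split; intros K.
  + apply (Rmult_le_compat_r D) in K; [|lra].
    replace (L / D * D) with L in K by (field; lra).
    destruct K as [K|K]; [now apply Rlt_le, exp_increasing|rewrite K; lra].
  + apply (Rmult_le_reg_r D); [lra|]. replace (L / D * D) with L by (field; lra).
    apply Rnot_lt_le. intros K'. apply exp_increasing in K'. lra.
- replace (Cmod (a n)) with 0 by (pose proof (Cmod_ge_0 (a n)); lra).
  split; intros _; [apply Rlt_le, exp_pos|].
  replace (Rbar_div m_infty (2 * PI * INR n)) with m_infty; [exact I|].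
  unfold Rbar_div. rewrite Rbar_mult_comm. symmetry. apply is_Rbar_mult_unique.
  apply is_Rbar_mult_sym, is_Rbar_mult_m_infty_pos. simpl. now apply Rinv_0_lt_compat.
Qed.

(** The bounds are asked for only at heights different from [y1], so constants
    and initial terms can be absorbed: [B] is at most
    [exp (2 pi (eps / 4) n)] for large [n]. *)
Lemma limsup_growth_rate (a : nat -> C) (y1 : R) :
  (forall y, y1 < y -> exists B, forall n, Cmod (a n) <= B * exp (2 * PI * y) ^ n) ->
  (forall y m, y < y1 -> ~ (forall n, (m <= n)%nat -> Cmod (a n) <= exp (2 * PI * y) ^ n)) ->
  Rbar_LimSup_seq (growth_rate a) = Finite y1.
Proof.
intros Hup Hlow. unfold Rbar_LimSup_seq. apply is_inf_seq_unique.
pose proof PI_RGT_0 as Hpi.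
intros [eps Heps]. cbn [pos]. split.
- intros m. apply Sup_seq_minor_lt. apply NNPP. intros Hno.
  apply (Hlow (y1 - eps) (S m)); [lra|]. intros n Hn.
  rewrite <- exp_nat_mult. apply growth_rate_le; [lia|].
  apply Rbar_not_lt_le. intros K. apply Hno. exists (n - m)%nat.
  replace (n - m + m)%nat with n by lia. exact K.
- destruct (Hup (y1 + eps / 4) ltac:(lra)) as [B HB].
  assert (Hx : 0 < exp (- (2 * PI * (eps / 4))) < 1).
  { split; [apply exp_pos|]. rewrite <- exp_0. apply exp_increasing.
    assert (0 < 2 * PI * (eps / 4)); [|lra]. apply Rmult_lt_0_compat; lra. }
  destruct (pow_lt_1_zero (exp (- (2 * PI * (eps / 4)))) ltac:(rewrite Rabs_pos_eq; lra) (/ (Rabs B + 1))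
    ltac:(apply Rinv_0_lt_compat; pose proof (Rabs_pos B); lra)) as [m Hm].
  exists (S m).
  apply Rbar_le_lt_trans with (Finite (y1 + eps / 2)); [|simpl; lra].
  apply Rbar_not_lt_le. intros K. apply Sup_seq_minor_lt in K. destruct K as [n K].
  apply (Rbar_lt_not_le _ _ K). apply growth_rate_le; [lia|].
  set (N := (n + S m)%nat). specialize (Hm N ltac:(unfold N; lia)).
  eapply Rle_trans; [apply (HB N)|]. rewrite exp_nat_mult.
  replace (2 * PI * (y1 + eps / 2)) with (2 * PI * (y1 + eps / 4) + 2 * PI * (eps / 4)) by field.
  rewrite exp_plus, Rpow_mult_distr, Rmult_comm.
  apply Rmult_le_compat_l; [apply pow_le, Rlt_le, exp_pos|].
  rewrite Rabs_pos_eq in Hm by (apply pow_le; lra).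
  rewrite exp_Ropp, pow_inv in Hm.
  assert (HE : 0 < exp (2 * PI * (eps / 4)) ^ N) by (apply pow_lt, exp_pos).
  set (E := exp (2 * PI * (eps / 4)) ^ N) in *.
  pose proof (Rabs_pos B). pose proof (Rle_abs B).
  apply Rinv_lt_cancel in Hm; lra.
Qed.

Lemma geometric_bound_shift (u : nat -> R) r M C0 : 0 < r ->
  (forall n, u (n + M)%nat <= C0 * r ^ n) ->
  exists C1, 0 <= C1 /\ forall n, u n <= C1 * r ^ n.
Proof.
intros Hr. revert C0. induction M as [|M IH]; intros C0 H.
- exists (Rabs C0). split; [apply Rabs_pos|]. intros n. specialize (H n). rewrite Nat.add_0_r in H.
  eapply Rle_trans; [exact H|]. apply Rmult_le_compat_r; [apply pow_le; lra|apply Rle_abs].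
- apply (IH (Rmax (u M) (C0 / r))). intros [|n].
  + simpl. rewrite Rmult_1_r. apply Rmax_l.
  + replace (S n + M)%nat with (n + S M)%nat by lia. eapply Rle_trans; [apply H|].
    replace (C0 * r ^ n) with (C0 / r * r ^ S n) by (simpl; field; lra).
    apply Rmult_le_compat_r; [apply pow_le; lra|apply Rmax_r].
Qed.

(** * Modular forms *)

Section Main.
Variables (N : nat) (k : Z) (f : C -> C) (y1 : R).
Hypothesis Hmod : meromorphic_modular_form N k f.
Hypothesis Hdiv : exists z, in_divisor_H f z /\ Im z = y1.
Hypothesis Hmax : forall z, in_divisor_H f z -> Im z <= y1.

Lemma y1_pos : 0 < y1.
Proof. destruct Hdiv as [z [[H _] <-]]. exact H. Qed.

Lemma holomorphic_above w : y1 < Im w -> holomorphic_at f w.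
Proof.
intros Hw. assert (HH : upper_half_plane w) by (pose proof y1_pos; unfold upper_half_plane; lra).
destruct (mmf_meromorphic _ _ _ Hmod w HH) as [H|[m [Hm Ho]]]; [exact H|].
exfalso. assert (Im w <= y1); [|lra]. apply Hmax. split; [exact HH|].
exists m. split; [lia|exact Ho].
Qed.

Lemma cdiff_above w : y1 < Im w -> cdiff f w.
Proof.
intros Hw. exact (locally_center _ _ (holomorphic_above w Hw)).
Qed.

(** A zero of finite order would lie in the divisor above height [y1].  If [f]
    vanished identically near a point, it would do so on the whole half-plane
    above [y1]; but it has no zeros just above the point of the divisor of height
    [y1], by [log_derivative_order]. *)
Lemma nonzero_above w : y1 < Im w -> f w <> 0%C.
Proof.
intros Hw H0.
destruct (zero_or_finite_order f w (holomorphic_above w Hw)) as [Hz|[m [Ho Hm]]].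
- destruct Hdiv as [z0 [[_ [m [_ Ho]]] Hy]].
  destruct (log_derivative_order f z0 m Ho) as [d [K [Hd HK]]].
  assert (E : (z0 + Ci * RtoC (d / 2) - z0)%C = (Ci * RtoC (d / 2))%C) by ring.
  assert (Ed : Cmod (Ci * RtoC (d / 2)) = d / 2).
  { rewrite Cmod_mult, Cmod_Ci, Cmod_R, Rabs_pos_eq by lra. ring. }
  destruct (HK (z0 + Ci * RtoC (d / 2))%C) as [Hne _].
  + intros E'. rewrite E' in E. rewrite <- E in Ed.
    replace (z0 - z0)%C with (RtoC 0) in Ed by ring. rewrite Cmod_0 in Ed. lra.
  + rewrite E, Ed. lra.
  + apply Hne. apply (identity_half_plane f y1 w); try assumption.
    * exact cdiff_above.
    * destruct z0 as [x y]. simpl in *. lra.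
- assert (Im w <= y1); [|lra]. apply Hmax. split.
  + pose proof y1_pos; unfold upper_half_plane; lra.
  + exists (Z.of_nat m). split; [|exact Ho]. intros E. apply Hm; [lia|exact H0].
Qed.

(** The translation [tau |-> tau + 1] belongs to every [Gamma0 N], with automorphy
    factor 1. *)
Lemma f_periodic : periodic_above y1 f.
Proof.
intros z Hz.
set (T := mkSL2Z 1 1 0 1 eq_refl).
assert (EM : moebius T z = (z + 1)%C).
{ unfold moebius, automorphy, ZtoC; simpl. field. }
assert (Hz1 : y1 < Im (z + 1)%C) by (destruct z; simpl in *; lra).
rewrite <- EM, (mmf_modular _ _ _ Hmod T z).
- unfold automorphy, ZtoC; simpl. replace (0 * z + 1)%C with (RtoC 1) by ring.
  assert (E1 : Cpowz (RtoC 1) k = 1%C).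
  { destruct k; simpl; rewrite ?Cpow_1_l; [reflexivity|reflexivity|]. field. }
  rewrite E1. ring.
- exists 0%Z. reflexivity.
- pose proof y1_pos; unfold upper_half_plane; lra.
- now apply holomorphic_above.
- rewrite EM. now apply holomorphic_above.
Qed.

Lemma C_derive_periodic : periodic_above y1 (C_derive f).
Proof.
intros z Hz.
apply is_C_derive_unique.
apply cderiv_ext_loc with (fun w => f (w - 1)%C).
- apply locally_Cmod. exists (Im z - y1). split; [lra|]. intros w Hw.
  rewrite <- (f_periodic (w - 1)%C).
  + f_equal. ring.
  + pose proof (Rmax_Cmod (w - (z + 1))%C) as Hm.
    pose proof (Rmax_r (Rabs (fst (w - (z + 1))%C)) (Rabs (snd (w - (z + 1))%C))).
    assert (Hs : Rabs (snd (w - (z + 1))%C) < Im z - y1) by lra.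
    apply Rabs_def2 in Hs. destruct z, w; simpl in *; lra.
- eapply cderiv_eq.
  + apply (cderiv_comp f (fun w => w - 1)%C _ (C_derive f z) (1 - 0)%C).
    * replace (z + 1 - 1)%C with z by ring. apply C_derive_correct; [exact z|]. now apply cdiff_above.
    * apply cderiv_minus; [apply cderiv_id|apply cderiv_const].
  + ring.
Qed.

Let F := fun tau : C => (- (Theta f tau / f tau))%C.

Lemma F_periodic : periodic_above y1 F.
Proof.
intros z Hz. unfold F, Theta. now rewrite C_derive_periodic, f_periodic.
Qed.

Lemma F_diff z : y1 < Im z -> cdiff F z.
Proof.
intros Hz.
apply cdiff_ext_loc with (fun w => (- / (RtoC (2 * PI) * Ci)) * (C_derive f w * / f w))%C.
- apply locally_Cmod. exists 1. split; [lra|]. intros w _. unfold F, Theta, Cdiv. ring.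
- apply cdiff_mult; [apply cdiff_const|]. apply cdiff_mult.
  + apply cdiff_derive. now apply holomorphic_above.
  + apply cdiff_inv; [now apply cdiff_above|now apply nonzero_above].
Qed.

(** Approach a point of the divisor of height [y1] from above: at distance [t]
    the polar part has modulus at least [1 / t], as [|m| >= 1]. *)
Lemma F_unbounded B0 : exists z, y1 < Im z /\ Im z <= y1 + 1 /\ B0 < Cmod (F z).
Proof.
destruct Hdiv as [z0 [[_ [m [Hm Ho]]] Hy]].
destruct (log_derivative_order f z0 m Ho) as [d [K [Hd HK]]].
pose proof PI_RGT_0 as Hpi.
(* [K] bounds the regular part and [2 pi] comes from [Theta]: polar parts larger
   than [L] make [|F| > B0]. *)
set (L := Rabs K + 2 * PI * Rabs B0 + 1).
assert (HL : 0 < L).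
{ unfold L. pose proof (Rabs_pos K). pose proof (Rabs_pos B0). nra. }
set (t := Rmin (Rmin (d / 2) 1) (/ L)).
assert (HiL : 0 < / L) by now apply Rinv_0_lt_compat.
assert (Ht : 0 < t) by (repeat apply Rmin_glb_lt; lra).
assert (Ht1 : t <= Rmin (d / 2) 1) by apply Rmin_l. assert (Ht2 : t <= / L) by apply Rmin_r.
pose proof (Rmin_l (d / 2) 1). pose proof (Rmin_r (d / 2) 1).
set (z := (z0 + Ci * RtoC t)%C).
assert (E : (z - z0)%C = (Ci * RtoC t)%C) by (unfold z; ring).
assert (Et : Cmod (z - z0) = t).
{ rewrite E, Cmod_mult, Cmod_Ci, Cmod_R, Rabs_pos_eq by lra. ring. }
assert (HzI : Im z = y1 + t) by (rewrite <- Hy; unfold z; destruct z0; simpl; ring).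
exists z. rewrite HzI. split; [lra|]. split; [lra|].
assert (Hzne : z <> z0).
{ intros E'. rewrite E' in Et. replace (z0 - z0)%C with (RtoC 0) in Et by ring. rewrite Cmod_0 in Et. lra. }
destruct (HK z Hzne ltac:(lra)) as [Hfz Hle].
assert (HF : Cmod (F z) = Cmod (C_derive f z / f z) / (2 * PI)).
{ replace (F z) with (- (C_derive f z / f z / (RtoC (2 * PI) * Ci)))%C.
  - rewrite Cmod_opp, Cmod_div by exact two_pi_i_nz.
    rewrite Cmod_mult, Cmod_Ci, Cmod_R, Rabs_pos_eq by lra. now rewrite Rmult_1_r.
  - assert (Hpc : RtoC (2 * PI) <> 0%C) by (intros E'; apply RtoC_inj in E'; lra).
    pose proof Ci_nz. unfold F, Theta. field. repeat split; assumption. }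
rewrite HF.
assert (Hm1 : L <= Cmod (ZtoC m / (z - z0))).
{ rewrite Cmod_div, Et by (now apply Cminus_eq_contra).
  unfold ZtoC. rewrite Cmod_R, <- abs_IZR.
  assert (1 <= IZR (Z.abs m)) by (apply IZR_le; lia).
  apply (Rmult_le_reg_r t); [lra|]. unfold Rdiv. rewrite Rmult_assoc, Rinv_l, Rmult_1_r by lra.
  assert (L * t <= L * / L) by (apply Rmult_le_compat_l; lra). rewrite Rinv_r in H2 by lra. lra. }
pose proof (Cmod_triangle_rev (ZtoC m / (z - z0)) (- (C_derive f z / f z - ZtoC m / (z - z0)))) as T.
replace (ZtoC m / (z - z0) - - (C_derive f z / f z - ZtoC m / (z - z0)))%C with (C_derive f z / f z)%C in T by ring.
rewrite Cmod_opp in T.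
apply (Rmult_lt_reg_r (2 * PI)); [lra|].
unfold Rdiv at 1. rewrite Rmult_assoc, Rinv_l, Rmult_1_r by lra.
pose proof (Rle_abs K). pose proof (Rle_abs B0). unfold L in Hm1. nra.
Qed.

Variable a : Z -> C.
Hypothesis Hexp : has_q_expansion 1 F a.

(** On a high line the coefficients are found termwise; [fourier_coef_shift]
    carries them down to every height above [y1], where the expansion itself is
    not known to converge. *)
Lemma coefficients_as_fourier : exists M Y,
  (exists B, forall z, Y < Im z -> Cmod (F z * expi (Z.of_nat M) z) <= B) /\
  forall y n, y1 < y -> fourier_coef (fun z => F z * expi (Z.of_nat M) z)%C (Z.of_nat n) y
                        = a (Z.of_nat n - Z.of_nat M)%Z.
Proof.
destruct Hexp as [M [_ [Y HY]]].
set (Yb := Rmax Y y1 + 1).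
assert (HYb1 : Y < Yb) by (unfold Yb; pose proof (Rmax_l Y y1); lra).
assert (HYb2 : y1 < Yb) by (unfold Yb; pose proof (Rmax_r Y y1); lra).
exists M, Yb. split.
- destruct (expansion_uniform F a M Y HY Yb HYb1) as [B [rho [_ [_ H]]]].
  exists B. intros z Hz. specialize (H z 0%nat ltac:(lra)). simpl in H.
  rewrite Rmult_1_r in H.
  now replace (F z * expi (Z.of_nat M) z - 0)%C with (F z * expi (Z.of_nat M) z)%C in H by ring.
- intros y n Hy.
  rewrite <- (expansion_coef F a M Y HY Yb n HYb1).
  + apply (fourier_coef_shift y1); [| |exact Hy|exact HYb2].
    * intros z Hz. apply cdiff_mult; [now apply F_diff|apply cdiff_expi].
    * intros z Hz. now rewrite expi_period, F_periodic.
  + intros z Hz. apply F_diff. lra.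
Qed.

(** Cauchy's estimate on the line of height [y] gives the upper bound.  For the
    lower bound, growth slower than [exp (2 pi n y)] with [y < y1] dominates the
    Fourier series of [q^M F] above height [y1] by a geometric series of ratio
    [x = exp (2 pi (y - y1))], and its sum contradicts [F_unbounded]. *)
Theorem growth_of_coefficients :
  Rbar_LimSup_seq (growth_rate (fun n => a (Z.of_nat n))) = Finite y1.
Proof.
destruct coefficients_as_fourier as [M [Y [[B HB] Hco]]].
set (Ft := fun z => (F z * expi (Z.of_nat M) z)%C) in *.
assert (Ftd : forall z, y1 < Im z -> cdiff Ft z).
{ intros z Hz. apply cdiff_mult; [now apply F_diff|apply cdiff_expi]. }
assert (Ftp : periodic_above y1 Ft).
{ intros z Hz. unfold Ft. now rewrite expi_period, F_periodic. }
assert (Hline : forall y, y1 < y -> exists K, 0 <= K /\ forall x, 0 <= x <= 1 -> Cmod (Ft (x, y)) <= K).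
{ intros y Hy. destruct (curve_bounded (fun x => Ft (x, y)) 0 1 ltac:(lra)) as [K HK].
  - intros t _. apply C_continuous_horizontal. unfold C_continuous. apply cdiff_continuous, Ftd, Hy.
  - exists K. split; [|exact HK]. eapply Rle_trans; [apply Cmod_ge_0|apply (HK 0); lra]. }
pose proof PI_RGT_0 as Hpi.
apply limsup_growth_rate.
- intros y Hy. destruct (Hline y Hy) as [K [HK HFt]].
  exists (K * exp (2 * PI * y) ^ M). intros n.
  replace (a (Z.of_nat n)) with (a (Z.of_nat (n + M) - Z.of_nat M)%Z) by (f_equal; lia).
  rewrite <- (Hco y (n + M)%nat Hy). unfold fourier_coef, period_mean.
  replace (K * exp (2 * PI * y) ^ M * exp (2 * PI * y) ^ n)
    with (K * exp (2 * PI * y) ^ (n + M) * (1 - 0)) by (rewrite pow_add; ring).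
  apply Cmod_CInt_le; [lra| |].
  + apply (ex_fourier_coef Ft). intros z Hz. apply Ftd. lra.
  + intros x Hx. rewrite Cmod_mult. apply Rmult_le_compat; try apply Cmod_ge_0; [now apply HFt|].
    right. rewrite Cmod_expi, <- exp_nat_mult, opp_IZR, <- INR_IZR_INZ. f_equal. simpl. ring.
- intros y m Hy Hno.
  set (r := exp (2 * PI * y)). assert (Hr : 0 < r) by apply exp_pos.
  (* The first [M + m] coefficients only enlarge the constant. *)
destruct (geometric_bound_shift (fun n => Cmod (a (Z.of_nat n - Z.of_nat M)%Z)) r (M + m) (r ^ m) Hr)
    as [C1 [HC1 Hb]].
  { intros n. replace (Z.of_nat (n + (M + m)) - Z.of_nat M)%Z with (Z.of_nat (n + m)) by lia.
    eapply Rle_trans; [apply Hno; lia|]. fold r. rewrite pow_add. lra. }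
  set (x := exp (2 * PI * (y - y1))).
  assert (Hx : 0 < x < 1).
  { split; [apply exp_pos|]. rewrite <- exp_0. apply exp_increasing.
    assert (0 < 2 * PI * (y1 - y)); [apply Rmult_lt_0_compat; lra|lra]. }
  assert (Hbd : forall t0, y1 < Im t0 -> Cmod (Ft t0) <= C1 / (1 - x)).
  { intros t0 Ht0. set (yl := (y1 + Im t0) / 2).
    assert (Hyl : y1 < yl < Im t0) by (unfold yl; lra).
    destruct (Hline yl (proj1 Hyl)) as [K [HK HFt]].
    assert (P := fun J => fourier_partial_sum y1 Ft Ftd Ftp t0 Ht0 Y B yl K J HB (proj1 Hyl) (proj2 Hyl) HFt).
    cbv zeta in P. set (rho := exp (- (2 * PI * (Im t0 - yl)))) in P.
    assert (Hrho : 0 < rho < 1).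
    { split; [apply exp_pos|]. rewrite <- exp_0. apply exp_increasing.
      assert (0 < 2 * PI * (Im t0 - yl)); [apply Rmult_lt_0_compat; lra|lra]. }
    set (u := fun n => (fourier_coef Ft (Z.of_nat n) yl * expi (Z.of_nat n) t0)%C) in P.
    assert (Hu : forall n, Cmod (u n) <= C1 * x ^ n).
    { intros n. unfold u. rewrite (Hco yl n (proj1 Hyl)), Cmod_mult, Cmod_expi_nat.
      specialize (Hb n). cbv beta in Hb.
      apply Rle_trans with (C1 * r ^ n * exp (- (2 * PI * Im t0)) ^ n).
      - apply Rmult_le_compat_r; [apply pow_le, Rlt_le, exp_pos|exact Hb].
      - rewrite Rmult_assoc, <- Rpow_mult_distr. apply Rmult_le_compat_l; [exact HC1|].
        apply pow_incr. split; [apply Rmult_le_pos; [lra|apply Rlt_le, exp_pos]|].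
        unfold r, x. rewrite <- exp_plus. apply Rlt_le, exp_increasing. nra. }
    set (D := (K + Cmod (Ft t0)) / (1 - rho)) in P.
    assert (HD : 0 <= D).
    { apply Rdiv_le_0_compat; [|lra]. pose proof (Cmod_ge_0 (Ft t0)). lra. }
    replace (Ft t0) with (Ft t0 - Csum u 0)%C by (simpl; ring).
    replace (C1 / (1 - x)) with (C1 / (1 - x) * x ^ 0) by (simpl; ring).
    apply Csum_tail_bound; [lra|exact HC1|exact Hu|].
    intros eps Heps.
    destruct (pow_lt_1_zero rho ltac:(rewrite Rabs_pos_eq; lra) (eps / (D + 1))
      ltac:(apply Rdiv_lt_0_compat; lra)) as [n0 Hn0].
    exists n0. intros n Hn. specialize (Hn0 n Hn). rewrite Rabs_pos_eq in Hn0 by (apply pow_le; lra).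
    rewrite <- Cmod_opp. replace (- (Csum u n - Ft t0))%C with (Ft t0 - Csum u n)%C by ring.
    eapply Rle_lt_trans; [apply P|].
    apply (Rmult_lt_compat_r (D + 1)) in Hn0; [|lra].
    replace (eps / (D + 1) * (D + 1)) with eps in Hn0 by (field; lra).
    pose proof (pow_lt rho n (proj1 Hrho)). nra. }
  (* [E] bounds [|q^M|] from below on the strip [y1 < Im z <= y1 + 1]. *)
set (E := exp (- (2 * PI * (y1 + 1))) ^ M).
  assert (HE : 0 < E) by (apply pow_lt, exp_pos).
  destruct (F_unbounded (C1 / (1 - x) / E)) as [z [Hz1 [Hz2 HFz]]].
  specialize (Hbd z Hz1). unfold Ft in Hbd. rewrite Cmod_mult, Cmod_expi_nat in Hbd.
  assert (HEz : E <= exp (- (2 * PI * Im z)) ^ M).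
  { apply pow_incr. split; [apply Rlt_le, exp_pos|].
    assert (HH : - (2 * PI * (y1 + 1)) <= - (2 * PI * Im z)) by nra.
    destruct HH as [HH|HH]; [now apply Rlt_le, exp_increasing|rewrite HH; lra]. }
  apply (Rmult_lt_compat_r E) in HFz; [|exact HE].
  replace (C1 / (1 - x) / E * E) with (C1 / (1 - x)) in HFz by (field; lra).
  pose proof (Cmod_ge_0 (F z)). nra.
Qed.

End Main.

Theorem corollary1p4 :
  forall (N : nat) (k : Z) (f : C -> C) (a : Z -> C) (y1 : R),
    (0 < N)%nat ->
    meromorphic_modular_form N k f ->
    (exists z : C, in_divisor_H f z) ->
    (exists z : C, in_divisor_H f z /\ Im z = y1) ->
    (forall z : C, in_divisor_H f z -> Im z <= y1) ->
    has_q_expansion 1 (fun tau : C => (- (Theta f tau / f tau))%C) a ->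
    Finite y1 =
    Rbar_LimSup_seq
      (fun n : nat =>
         Rbar_div (Rbar_ln (Cmod (a (Z.of_nat n))))
                  (Finite (2 * PI * INR n))).
Proof.
intros N k f a y1 _ Hmod _ Hdiv Hmax Hexp. symmetry.
exact (growth_of_coefficients N k f y1 Hmod Hdiv Hmax a Hexp).
Qed.
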